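(* Let $\psi$ be a Minkowski norm and $\phi$ a positively $1$-homogeneous function on $\mathbb{R}^n$ such that $\psi+\phi$ is a weak Minkowski norm and one of the following holds: (A) $\phi(y)\ge\psi(y)$ for all $y$, with equality only at $y=\mathbf 0$; (B) $-\psi(y)\le\phi(y)\le\psi(y)$ for all $y$, with equality only at $y=\mathbf 0$. Let $\Omega:=\{x\in\mathbb{R}^n:\phi(x)+\psi(x)<1\}$ and define $F:\Omega\times\mathbb{R}^n\to\mathbb{R}$ by $$F(x,y):=\tfrac12\{\Phi_+(x,y)-\Phi_-(x,y)\},$$ where $\Phi_\pm=\Phi_\pm(x,y)$ are the unique solutions to $\Phi_\pm=(\phi\pm\psi)(y+x\Phi_\pm)$ for all $(x,y)\in\Omega\times\mathbb{R}^n$. Let $\mathscr O:=\{x\in\Omega:F(x,\cdot)\text{ is a Minkowski norm}\}$ and let $U$ be a convex connected component of $\mathscr O$. Then the following hold: (a) for any smooth point $x\in\partial U\cap\Omega$ and any vector $y$ not tangent to $\partial U$ at $x$, the matrix $([F^2]_{y^iy^j}(x,y))$ is positive definite; (b) for any smooth point $x\in\partial U\cap\Omega$, there exists a nonzero vector $y$ tangent to $\partial U$ at $x$ such that $([F^2]_{y^iy^j}(x,y))$ has a zero eigenvalue. Moreover, the corresponding eigenvector $\theta=(\theta^i)$ is not parallel to $y$ and satisfies $$F_{y^i}(x,y)\theta^i=0,\qquad F_{y^iy^j}(x,y)\theta^i\theta^j=0.$$ If, in addition, the vector $x$ is not tangent to $\partial U$ at the point $x$, then for all sufficiently small $|t|\neq0$,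 $$F_{y^iy^j}(x,y+tx)\theta^i\theta^j>0.$$
   Context: Throughout $n\ge2$; subscripts $y^i$ denote partial derivatives, repeated indices are summed. A function $\phi$ is positively $1$-homogeneous if $\phi(\alpha y)=\alpha\phi(y)$ for $\alpha>0$. A pseudo-norm on $\mathbb{R}^n$ is a positively $1$-homogeneous function $\varphi\ge0$ vanishing only at $\mathbf 0$ with $\varphi(y_1+y_2)\le\varphi(y_1)+\varphi(y_2)$. It is a weak Minkowski norm if it is smooth on $\mathbb{R}^n\setminus\{\mathbf 0\}$ and equality in the triangle inequality holds only if $\alpha_1y_1=\alpha_2y_2$ for some $\alpha_1,\alpha_2\ge0$, $\alpha_1+\alpha_2>0$. It is a Minkowski norm if moreover $([\varphi^2]_{y^iy^j}(y))$ is positive definite for all $y\ne\mathbf 0$. It is part of the setting that the equations for $\Phi_\pm$ have unique solutions on $\Omega\times\mathbb{R}^n$. A smooth point of $\partial U$ is a point at which the boundary of the convex set $U$ has a (unique) tangent hyperplane; a vector is tangent to $\partial U$ at $x$ if it lies in the direction space of that hyperplane. *)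

(* Defs.v *)
From HB Require Import structures.
From mathcomp Require Import all_boot all_order all_algebra.
From mathcomp Require Import all_classical all_reals all_analysis.
Set Implicit Arguments.
Unset Strict Implicit.
Unset Printing Implicit Defensive.
Import Order.TTheory GRing.Theory Num.Theory.
Import numFieldNormedType.Exports.
Local Open Scope classical_set_scope.
Local Open Scope ring_scope.

Definition dotp (R : realType) (n : nat) (u v : 'rV[R]_n) : R :=
  \sum_(i < n) u 0 i * v 0 i.

Definition partial (R : realType) (n : nat) (i : 'I_n) (f : 'rV[R]_n -> R)
    (y : 'rV[R]_n) : R :=
  'D_(delta_mx 0 i) f y.

(* [iter_partial [:: i1; ...; ik] f] is d_{i1} (... (d_{ik} f)). *)
Fixpoint iter_partial (R : realType) (n : nat) (s : seq 'I_n)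
    (f : 'rV[R]_n -> R) : 'rV[R]_n -> R :=
  if s is i :: s' then partial i (iter_partial s' f) else f.

(* C^oo on A, for an open set A. *)
Definition smooth_on (R : realType) (n : nat) (A : set 'rV[R]_n)
    (f : 'rV[R]_n -> R) : Prop :=
  forall (s : seq 'I_n) (y : 'rV[R]_n), A y ->
    {for y, continuous (iter_partial s f)} /\
    (forall i : 'I_n, derivable (iter_partial s f) y (delta_mx 0 i)).

Definition hessian (R : realType) (n : nat) (f : 'rV[R]_n -> R)
    (y : 'rV[R]_n) : 'M[R]_n :=
  \matrix_(i, j) partial j (partial i f) y.

Definition posdef (R : realType) (n : nat) (H : 'M[R]_n) : Prop :=
  H^T = H /\ forall v : 'rV[R]_n, v != 0 -> 0 < (v *m H *m v^T) 0 0.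

Definition pos_homogeneous (R : realType) (n : nat)
    (f : 'rV[R]_n -> R) : Prop :=
  forall (a : R) (y : 'rV[R]_n), 0 < a -> f (a *: y) = a * f y.

Definition pseudo_norm (R : realType) (n : nat) (f : 'rV[R]_n -> R) : Prop :=
  [/\ pos_homogeneous f,
      forall y, 0 <= f y,
      forall y, f y = 0 -> y = 0
    & forall y1 y2, f (y1 + y2) <= f y1 + f y2].

Definition weak_Minkowski_norm (R : realType) (n : nat)
    (f : 'rV[R]_n -> R) : Prop :=
  [/\ pseudo_norm f,
      smooth_on [set y | y != 0] f
    & forall y1 y2, f (y1 + y2) = f y1 + f y2 ->
        exists a1 a2 : R,
          [/\ 0 <= a1, 0 <= a2, 0 < a1 + a2 & a1 *: y1 = a2 *: y2]].

Definition Minkowski_norm (R : realType) (n : nat)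
    (f : 'rV[R]_n -> R) : Prop :=
  weak_Minkowski_norm f /\
  forall y, y != 0 -> posdef (hessian (fun z => f z ^+ 2) y).

Definition boundary (T : topologicalType) (A : set T) : set T :=
  closure A `\` interior A.

(* H is the direction space of a supporting hyperplane x + H of U at x. *)
Definition supporting_direction (R : realType) (n : nat) (U : set 'rV[R]_n)
    (x : 'rV[R]_n) (H : set 'rV[R]_n) : Prop :=
  exists a : 'rV[R]_n,
    [/\ a != 0, H = [set v | dotp a v = 0]
      & forall u, U u -> dotp a (u - x) <= 0].

(* As usual in convex analysis, a hyperplane is tangent to a convex set U at a
   boundary point x when it is the only supporting hyperplane of U at x. *)
Definition tangent_direction (R : realType) (n : nat) (U : set 'rV[R]_n)
    (x : 'rV[R]_n) (H : set 'rV[R]_n) : Prop :=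
  supporting_direction U x H /\
  forall H', supporting_direction U x H' -> H' = H.

Definition smooth_boundary_point (R : realType) (n : nat) (U : set 'rV[R]_n)
    (x : 'rV[R]_n) : Prop :=
  boundary U x /\ exists H, tangent_direction U x H.

Definition tangent_at (R : realType) (n : nat) (U : set 'rV[R]_n)
    (x y : 'rV[R]_n) : Prop :=
  exists2 H, tangent_direction U x H & H y.

Definition Omega (R : realType) (n : nat) (phi psi : 'rV[R]_n -> R) :
    set 'rV[R]_n :=
  [set x | phi x + psi x < 1].

Definition Minkowski_locus (R : realType) (n : nat) (W : set 'rV[R]_n)
    (F : 'rV[R]_n -> 'rV[R]_n -> R) : set 'rV[R]_n :=
  [set x | W x /\ Minkowski_norm (F x)].

(* Main.v *)
(* Put G = phi + psi or G = phi - psi. If s = Phi(x,y) solves s = G(y + s x) and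
   z = y + s x, then dPhi = dG(z) / (1 - dG(z) x) and
     Hess_y Phi(u,v) = Hess G(z)(u + dPhi(u) x, v + dPhi(v) x) / (1 - dG(z) x).
   Replacing x by x + t y rescales z to z / (1 - t s), so, Hess G(z) being
   homogeneous of degree -1 and annihilating z, the form Hess_y Phi(x + t y, y) does
   not depend on t. Hence Hess_y F(x,y) is constant along the line x + R y.
   Since Hess(F^2) is positive definite iff Hess F is positive transversally to y,
   and a non-tangent line through a smooth boundary point x meets U, (a) follows.
   The Minkowski locus is open (compactness of the sphere), so F(x,.) fails to be a
   Minkowski norm at a boundary point x; by (a) it fails in a tangent direction y,
   where Hess(F^2) is positive semidefinite as a limit from U. The remaining claims
   are Euler's relations for the kernel of this form, and (a) applied to y + t x. *)
Require Import Defs.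
From HB Require Import structures.
From mathcomp Require Import all_boot all_order all_algebra.
From mathcomp Require Import all_classical all_reals all_analysis.
From mathcomp Require Import ring lra.
Import Order.TTheory GRing.Theory Num.Theory.
Import numFieldNormedType.Exports.
Local Open Scope classical_set_scope.
Local Open Scope ring_scope.

(** * Differential calculus on row vectors *)

Section Calculus.
Context {R : realType} {n : nat}.
Implicit Types (f g : 'rV[R]_n -> R) (y v : 'rV[R]_n).

(** The source is uniqueness of the solution: imposed at every base point of the line [y + R x], it
    makes [s - G(y + s x)] injective, hence monotone, and a slightly longer [x] turns the weak
    inequality for the derivative into a strict one. The same monotonicity replaces the implicit
    function theorem: it traps the root, which gives continuity, and the mean value theorem then
    gives the derivative. A second obstacle is that being a Minkowski norm includes the triangle
    inequality and its equality case, which cannot be checked one direction at a time. Both are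
    recovered from the transversal positivity of the Hessian, so that only Hessians have to be
    compared between different points [x]. *)

Lemma coord_le_norm y i : `|y 0 i| <= `|y|.
Proof.
have -> : `|y| = mx_norm y by []; rewrite mx_normrE; apply/bigmax_geP; right => /=.
by exists (0, i).
Qed.

Lemma norm_le_coord y (e : R) : 0 <= e -> (forall i, `|y 0 i| <= e) -> `|y| <= e.
Proof.
move=> e0 h; have -> : `|y| = mx_norm y by []; rewrite mx_normrE; apply/bigmax_leP; split => //.
by move=> [i j] _ /=; rewrite ord1.
Qed.

Lemma is_derive_line f y v (t : R) : derivable f (y + t *: v) v ->
  is_derive t 1 (fun s : R => f (y + s *: v)) ('D_v f (y + t *: v)).
Proof.
move=> df.
have E : (fun h : R => h^-1 *: (((fun s : R => f (y + s *: v)) \o shift t)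
            (h *: 1) - f (y + t *: v))) =
         (fun h : R => h^-1 *: ((f \o shift (y + t *: v)) (h *: v) - f (y + t *: v))).
  by apply/funext => h /=; rewrite [_%:A]mulr1 scalerDl addrCA.
by apply: DeriveDef; rewrite /derivable /derive E.
Qed.

(** Only [|t| <= |a|] is claimed, so that one statement covers both signs of [a]. *)
Lemma MVT_line f y v (a : R) :
  (forall t, `|t| <= `|a| -> derivable f (y + t *: v) v) ->
  exists2 t, `|t| <= `|a| & f (y + a *: v) - f y = a * 'D_v f (y + t *: v).
Proof.
move=> df; pose F s := f (y + s *: v).
have isF (t : R) : `|t| <= `|a| -> is_derive t 1 F ('D_v f (y + t *: v)).
  by move=> /df; exact: is_derive_line.
have E0 : F 0 = f y by rewrite /F scale0r addr0.
have [a0|a0] := leP 0 a.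
- have itv (t : R) : t \in `[0, a] -> `|t| <= `|a|.
    by rewrite in_itv/= => /andP[t0 ta]; rewrite !ger0_norm.
  have [t ta E] := @MVT_segment R F (fun s => 'D_v f (y + s *: v)) 0 a a0
    (fun t ta => isF t (itv _ (subset_itv_oo_cc ta)))
    (derivable_within_continuous (fun t ta => @ex_derive _ _ _ _ _ _ _ (isF t (itv _ ta)))).
  by exists t; [exact: itv|rewrite -E0 E subr0 mulrC].
- have itv (t : R) : t \in `[a, 0] -> `|t| <= `|a|.
    by rewrite in_itv/= => /andP[t0 ta]; rewrite !ler0_norm ?lerN2// ltW.
  have [t ta E] := @MVT_segment R F (fun s => 'D_v f (y + s *: v)) a 0 (ltW a0)
    (fun t ta => isF t (itv _ (subset_itv_oo_cc ta)))
    (derivable_within_continuous (fun t ta => @ex_derive _ _ _ _ _ _ _ (isF t (itv _ ta)))).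
  exists t; first exact: itv.
  by rewrite -E0 -opprB E sub0r mulrN opprK mulrC.
Qed.

Lemma dotp_linear (a : 'rV[R]_n) : linear (dotp a).
Proof.
move=> k u v; rewrite /dotp scaler_sumr -big_split/=; apply: eq_bigr => i _.
by rewrite !mxE mulrDr mulrCA.
Qed.

HB.instance Definition _ (a : 'rV[R]_n) :=
  GRing.isLinear.Build R 'rV[R]_n R _ (dotp a) (dotp_linear a).

Lemma dotp_le_norm (a v : 'rV[R]_n) : `|dotp a v| <= (\sum_i `|a 0 i|) * `|v|.
Proof.
rewrite mulr_suml (le_trans (ler_norm_sum _ _ _))// ler_sum// => i _.
by rewrite normrM ler_wpM2l// coord_le_norm.
Qed.

Lemma cvg_row {T : Type} {F : set_system T} {FF : Filter F}
  (f : T -> 'rV[R]_n) (l : 'rV[R]_n) :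
  (forall i, (fun t => f t 0 i) @ F --> l 0 i) -> f @ F --> l.
Proof.
move=> fl; apply/cvgrPdist_le => e e0.
have : F [set t | forall i, `|l 0 i - f t 0 i| <= e].
  apply: (@filter_forall _ _ (fun i t => `|l 0 i - f t 0 i| <= e) F _) => i.
  by have /cvgrPdist_le/(_ _ e0) := fl i.
apply: filterS => t ht; apply: norm_le_coord; first exact: ltW.
by move=> i; rewrite !mxE; exact: ht.
Qed.

Lemma cvg_dotp {T : Type} {F : set_system T} {FF : Filter F}
  (f g : T -> 'rV[R]_n) (a b : 'rV[R]_n) :
  f @ F --> a -> g @ F --> b -> (fun x => dotp (f x) (g x)) @ F --> dotp a b.
Proof.
move=> fa gb; apply: cvg_big; first exact: add_continuous.
move=> i _; apply: cvgM.
  apply: (@cvg_comp _ _ _ f (fun M : 'rV_n => M 0 i) _ _ _ fa).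
  exact: coord_continuous.
apply: (@cvg_comp _ _ _ g (fun M : 'rV_n => M 0 i) _ _ _ gb).
exact: coord_continuous.
Qed.

Lemma dotp_continuous (a : 'rV[R]_n) : continuous (dotp a).
Proof. by move=> v; apply: (@cvg_dotp _ (nbhs v) _ (fun=> a) id); [exact: cvg_cst|exact: cvg_id]. Qed.

Definition grad f y : 'rV[R]_n := \row_i partial i f y.

(* Change one coordinate at a time and apply the mean value theorem to each step. *)
Lemma C1_diff f y :
  (forall i, \forall z \near y, derivable f z 'e_i) ->
  (forall i, {for y, continuous (partial i f)}) ->
  differentiable f y /\ 'd f y = dotp (grad f y) :> (_ -> _).
Proof.
move=> df cf.
have E : f \o shift y = cst (f y) + dotp (grad f y) +o_ (0 : 'rV[R]_n) id.
  apply/eqaddoP => _/posnumP[e].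
  (* There are [n] coordinate steps, each with error at most [e' * |h|]; dividing by [n.+1] keeps
     the denominator nonzero for [n = 0]. *)
  pose e' := e%:num / n.+1%:R.
  have e'0 : 0 < e' by rewrite divr_gt0.
  have : nbhs y [set z | forall i : 'I_n, derivable f z 'e_i /\
      `|partial i f z - partial i f y| <= e'].
    apply: (@filter_forall _ _ (fun i z => derivable f z 'e_i /\
      `|partial i f z - partial i f y| <= e') (nbhs y) _) => i; apply: filterI; first exact: df.
    by have /cvgrPdist_le/(_ _ e'0) := cf i; apply: filterS => z; rewrite distrC.
  move=> /nbhs_ballP[r /= r0 hr].
  near=> h.
  have hlt : `|h| < r by near: h; exact: (@nbhs0_lt _ 'rV[R]_n).
  (* Truncation of [h] to its first [k] coordinates: a path from [0] to [h] parallel to the axes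
     that never exceeds [|h|] in sup norm. *)
  pose tr k : 'rV[R]_n := \row_j (if (j < k)%N then h 0 j else 0).
  have trS (k : 'I_n) : tr k.+1 = tr k + h 0 k *: 'e_k.
    apply/rowP => j; rewrite !mxE ltnS leq_eqVlt eqxx/= -val_eqE/=.
    case: eqVneq => [/val_inj->|jk] /=; first by rewrite ltnn mulr1 add0r.
    by rewrite mulr0 addr0.
  have tr0 : tr 0%N = 0 by apply/rowP => j; rewrite !mxE.
  have trn : tr n = h by apply/rowP => j; rewrite !mxE ltn_ord.
  have inb (k : 'I_n) t : `|t| <= `|h 0 k| -> ball y r (y + tr k + t *: 'e_k).
    move=> th; rewrite -ball_normE /ball_/= -addrA opprD addrA subrr sub0r normrN.
    apply: le_lt_trans hlt; apply: norm_le_coord => // i.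
    rewrite !mxE eqxx/=; case: eqVneq => [->|_].
      by rewrite ltnn add0r mulr1 (le_trans th)// coord_le_norm.
    by rewrite mulr0 addr0; case: ifP => _; rewrite ?coord_le_norm ?normr0.
  have mv (k : 'I_n) : `|f (y + tr k.+1) - f (y + tr k) - h 0 k * partial k f y|
       <= e' * `|h|.
    have [t th] := MVT_line f (y + tr k) 'e_k (h 0 k)
      (fun t ht => (hr _ (inb k t ht) k).1).
    rewrite -addrA -trS => ->.
    rewrite -mulrBr normrM mulrC ler_pM ?coord_le_norm//.
    exact: (hr _ (inb k t th) k).2.
  rewrite (_ : _ h = \sum_(k < n) (f (y + tr k.+1) - f (y + tr k)
       - h 0 k * partial k f y)); last first.
    rewrite sumrB.
    have -> : \sum_(k < n) (f (y + tr k.+1) - f (y + tr k)) = f (y + h) - f y.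
      rewrite -(big_mkord xpredT (fun k => f (y + tr k.+1) - f (y + tr k))).
      by rewrite telescope_sumr// trn tr0 addr0.
    have -> : (f \o shift y - (cst (f y) + dotp (grad f y))) h =
        f (h + y) - (f y + dotp (grad f y) h) by [].
    rewrite opprD addrA [h + y]addrC /dotp; congr (_ - _).
    by apply: eq_bigr => i _; rewrite mxE mulrC.
  rewrite (le_trans (ler_norm_sum _ _ _))//.
  apply: (@le_trans _ _ (\sum_(k < n) e' * `|h|)); first exact: ler_sum.
  rewrite sumr_const card_ord -mulr_natl mulrA ler_wpM2r//.
  by rewrite mulrCA ler_piMr// ler_pdivrMr// mul1r ler_nat.
have dE := diff_unique (@dotp_continuous (grad f y)) E.
split=> //; apply/diff_locallyP; split.
  by rewrite dE; exact: dotp_continuous.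
by rewrite dE.
Unshelve. all: by end_near. Qed.

End Calculus.

(** * Smooth functions on open sets and Schwarz's theorem *)

Section Smooth.
Context {R : realType} {n : nat}.
Implicit Types (f g : 'rV[R]_n -> R) (y v : 'rV[R]_n) (A : set 'rV[R]_n).

Lemma near_open A y : open A -> A y -> \forall z \near y, A z.
Proof. by move=> oA Ay; apply: open_nbhs_nbhs. Qed.

Lemma smooth_partial A f i : smooth_on A f -> smooth_on A (partial i f).
Proof.
move=> sf s y Ay.
have -> : iter_partial s (partial i f) = iter_partial (rcons s i) f.
  by elim: s => //= j s ->.
exact: sf.
Qed.

Lemma smooth_diff A f y : open A -> smooth_on A f -> A y ->
  differentiable f y /\ 'd f y = dotp (grad f y) :> (_ -> _).
Proof.
move=> oA sf Ay; apply: C1_diff => i.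
  by apply: filterS (near_open _ _ oA Ay) => z Az; exact: (sf [::] z Az).2.
exact: (sf [:: i] y Ay).1.
Qed.

Lemma smooth_derive A f y v : open A -> smooth_on A f -> A y ->
  'D_v f y = dotp (grad f y) v.
Proof. by move=> oA sf Ay; have [df <-] := smooth_diff _ _ _ oA sf Ay; exact: deriveE. Qed.

Lemma derivable_shift f c y v :
  derivable (fun z => f (z + c)) y v = derivable f (y + c) v.
Proof. by rewrite /derivable; under eq_fun do rewrite /= -addrA. Qed.

Lemma derive_shiftr f c y v :
  'D_v (fun z => f (z + c)) y = 'D_v f (y + c).
Proof. by rewrite /derive; under eq_fun do rewrite /= -addrA. Qed.

(* Symmetric in [i] and [j] up to the location of [p]; this yields Schwarz's theorem. *)
Lemma second_difference f y i j (h : R) :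
  (forall z, `|z - y| <= `|h| + `|h| ->
     derivable f z 'e_i /\ derivable (partial i f) z 'e_j) ->
  exists2 p, `|p - y| <= `|h| + `|h| &
   f (y + h *: 'e_i + h *: 'e_j) - f (y + h *: 'e_i) - (f (y + h *: 'e_j) - f y)
     = h * (h * partial j (partial i f) p).
Proof.
move=> df.
have ne (k : 'I_n) : `|('e_k : 'rV[R]_n)| <= 1.
  by apply: norm_le_coord => // l; rewrite mxE; case: (_ && _); rewrite ?normr1 ?normr0 ?ler01.
have nd t s : `|t| <= `|h| -> `|s| <= `|h| ->
    `|y + t *: 'e_i + s *: 'e_j - y| <= `|h| + `|h|.
  move=> th sh; rewrite -[_ + _ *: 'e_j]addrA addrAC subrr add0r (le_trans (ler_normD _ _))//.
  by rewrite !normrZ lerD// -[leRHS]mulr1 ler_pM.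
have nd0 t : `|t| <= `|h| -> `|y + t *: 'e_i - y| <= `|h| + `|h|.
  by move=> th; have := nd t 0 th; rewrite scale0r addr0; apply; rewrite normr0.
pose g z := f (z + h *: 'e_j) - f z.
have dfh z : derivable f (z + h *: 'e_j) 'e_i ->
    derivable (fun z => f (z + h *: 'e_j)) z 'e_i by rewrite derivable_shift.
have dg t : `|t| <= `|h| -> derivable g (y + t *: 'e_i) 'e_i.
  move=> th; apply: derivableB; first by apply/dfh; exact: (df _ (nd _ _ th _)).1.
  exact: (df _ (nd0 _ th)).1.
have [t th E] := MVT_line g y 'e_i h dg.
have [s sh E'] := MVT_line (partial i f) (y + t *: 'e_i) 'e_j h
  (fun s hs => (df _ (nd _ _ th hs)).2).
exists (y + t *: 'e_i + s *: 'e_j); first exact: nd.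
rewrite -[LHS]/(g (y + h *: 'e_i) - g y) E; congr (_ * _).
rewrite deriveB; last 2 first.
- by apply/dfh; exact: (df _ (nd _ _ th _)).1.
- exact: (df _ (nd0 _ th)).1.
by rewrite derive_shiftr -E'.
Qed.

Lemma smooth_schwarz A f y i j : open A -> smooth_on A f -> A y ->
  partial j (partial i f) y = partial i (partial j f) y.
Proof.
move=> oA sf Ay; apply/eqP; rewrite -subr_eq0 -normr_le0.
apply/ler_addgt0Pl => e e0; rewrite addr0.
have near_cont k l : \forall z \near y, `|partial l (partial k f) y - partial l (partial k f) z| < e / 2.
  have /cvgrPdist_lt := (sf [:: l; k] y Ay).1; apply; exact: divr_gt0.
have : \forall z \near y, [/\ A z,
   `|partial j (partial i f) y - partial j (partial i f) z| < e / 2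
   & `|partial i (partial j f) y - partial i (partial j f) z| < e / 2].
  by apply: filterS3 (near_open _ _ oA Ay) (near_cont i j) (near_cont j i) => z; split.
move=> /nbhs_ballP[r /= r0 hr].
(* The intermediate points lie within [2 h] of [y], and [2 h < r]. *)
pose h := r / 3.
have h0 : 0 < h by rewrite divr_gt0.
have hin z : `|z - y| <= `|h| + `|h| -> ball y r z.
  rewrite -ball_normE /ball_/= distrC => /le_lt_trans; apply.
  by rewrite gtr0_norm// /h; lra.
have [p /hin/hr[_ pij _] E] := second_difference f y i j h
  (fun z hz => let: And3 Az _ _ := hr z (hin z hz) in
     conj ((sf [::] z Az).2 i) ((sf [:: i] z Az).2 j)).
have [q /hin/hr[_ _ qij] E'] := second_difference f y j i h
  (fun z hz => let: And3 Az _ _ := hr z (hin z hz) in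
     conj ((sf [::] z Az).2 j) ((sf [:: j] z Az).2 i)).
have pq : partial j (partial i f) p = partial i (partial j f) q.
  apply: (mulfI (lt0r_neq0 h0)); apply: (mulfI (lt0r_neq0 h0)).
  apply: (etrans (esym E) (etrans _ E')); rewrite (addrAC y (h *: 'e_j) (h *: 'e_i)).
  move: (f (y + h *: 'e_i + h *: 'e_j)) (f (y + h *: 'e_i)) (f (y + h *: 'e_j)) (f y).
  move=> a b c d; ring.
rewrite pq in pij; move: pij qij.
move: (partial j _ y) (partial i _ y) (partial i _ q) => a b c ac bc.
have -> : a - b = (a - c) - (b - c) by rewrite opprB addrA subrK.
by apply: (le_trans (ler_normB _ _)); rewrite [leRHS]splitr; apply: lerD; exact: ltW.
Qed.

Lemma near_eq_continuous f g y : (\forall z \near y, f z = g z) ->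
  {for y, continuous f} -> {for y, continuous g}.
Proof.
move=> fg cf; have fgy : f y = g y := nbhs_singleton fg.
have : g @ y --> f y by apply: cvg_trans cf; exact: (@near_eq_cvg _ _ (nbhs y) _ f g fg).
by rewrite fgy.
Qed.

(** Coinduction for smoothness: by induction on the list of indices, every iterated partial
    derivative agrees on [A] with a member of [K], and agreement on an open set passes to
    derivatives and continuity. *)
Lemma smooth_coind A (K : set ('rV[R]_n -> R)) : open A ->
  (forall f, K f -> forall y, A y ->
     {for y, continuous f} /\ forall i : 'I_n, derivable f y 'e_i) ->
  (forall f (i : 'I_n), K f -> exists2 g, K g & forall y, A y -> partial i f y = g y) ->
  forall f, K f -> smooth_on A f.
Proof.
move=> oA Kd Kp f Kf s.
have [g Kg fg] : exists2 g, K g & forall y, A y -> iter_partial s f y = g y.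
  elim: s => [|i s [g Kg fg]] /=; first by exists f.
  have [g' Kg' gg'] := Kp _ i Kg; exists g' => // y Ay; rewrite -gg'//.
  apply: near_eq_derive.
  by apply: filterS (near_open _ _ oA Ay) => z; exact: fg.
move=> y Ay; have [cg dg] := Kd _ Kg y Ay.
have nfg : \forall z \near y, g z = iter_partial s f z.
  by apply: filterS (near_open _ _ oA Ay) => z Az; rewrite fg.
split; last by move=> i; exact: near_eq_derivable (dg i).
exact: near_eq_continuous nfg cg.
Qed.

Lemma smooth_cst A (c : R) : open A -> smooth_on A (cst c).
Proof.
move=> oA; apply: (@smooth_coind A [set f | exists c, f = cst c]) => //.
- move=> _ [a ->] y _; split; first exact: cst_continuous.
  by move=> i; exact: derivable_cst.
- move=> _ i [a ->]; exists (cst 0); first by exists 0.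
  by move=> y _; rewrite /partial derive_cst.
- by exists c.
Qed.

(** The rules of differentiation express the derivative of a sum, product or inverse by the same
    operations, so this class is stable under [partial] and [smooth_coind] applies to it. *)
Inductive smooth_closure A : ('rV[R]_n -> R) -> Prop :=
| SmoothBase f : smooth_on A f -> smooth_closure A f
| SmoothAdd f g : smooth_closure A f -> smooth_closure A g -> smooth_closure A (f + g)
| SmoothMul f g : smooth_closure A f -> smooth_closure A g -> smooth_closure A (f * g)
| SmoothInv f : smooth_closure A f -> (forall y, A y -> f y != 0) ->
    smooth_closure A (fun y => (f y)^-1).

Lemma smooth_closureP A f : open A -> smooth_closure A f -> smooth_on A f.
Proof.
move=> oA; apply: (@smooth_coind A (smooth_closure A)) => // {f}.
- move=> f; elim => {f}.
  + by move=> f sf y Ay; exact: (sf [::] y Ay).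
  + move=> f g _ ihf _ ihg y Ay; have [? ?] := ihf y Ay; have [? ?] := ihg y Ay.
    by split=> [|i]; [exact: continuousD|exact: derivableD].
  + move=> f g _ ihf _ ihg y Ay; have [? ?] := ihf y Ay; have [? ?] := ihg y Ay.
    by split=> [|i]; [apply: (@continuousM R _ f g)|apply: (@derivableM R _ f g)].
  + move=> f _ ihf f0 y Ay; have [? ?] := ihf y Ay.
    split=> [|i]; first by apply: continuousV => //; exact: f0.
    by apply: derivableV => //; exact: f0.
- move=> f i Kf.
  (* Strengthened for the induction: the product and inverse rules need derivability of the operands
     along with a formula for their derivatives. *)
  suff : (forall y, A y -> {for y, continuous f} /\ derivable f y 'e_i) /\
    exists2 g, smooth_closure A g & forall y, A y -> partial i f y = g y by case.
  elim: Kf => {f}.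
  + move=> f sf; split; first by move=> y Ay; have [? +] := sf [::] y Ay; split.
    by exists (partial i f) => //; apply: SmoothBase; exact: smooth_partial.
  + move=> f g _ [df [f' sf' Ef]] _ [dg [g' sg' Eg]]; split.
      move=> y Ay; have [? ?] := df y Ay; have [? ?] := dg y Ay.
      by split; [exact: continuousD|exact: derivableD].
    exists (f' + g'); first exact: SmoothAdd.
    move=> y Ay; rewrite /partial deriveD; [|exact: (df _ Ay).2|exact: (dg _ Ay).2].
    by rewrite -/(partial i f y) -/(partial i g y) Ef// Eg.
  + move=> f g sf [df [f' sf' Ef]] sg [dg [g' sg' Eg]]; split.
      move=> y Ay; have [cf dfy] := df y Ay; have [cg dgy] := dg y Ay.
      by split; [exact: (@continuousM R _ f g y cf cg)|exact: (derivableM dfy dgy)].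
    exists (f * g' + g * f'); first by apply: SmoothAdd; apply: SmoothMul.
    move=> y Ay; rewrite /partial deriveM; [|exact: (df _ Ay).2|exact: (dg _ Ay).2].
    by rewrite -/(partial i f y) -/(partial i g y) Ef// Eg.
  + move=> f sf [df [f' sf' Ef]] f0; split.
      move=> y Ay; have [? ?] := df y Ay; split.
        by apply: continuousV => //; exact: f0.
      by apply: derivableV => //; exact: f0.
    exists (cst (-1) * ((fun y => (f y)^-1) * (fun y => (f y)^-1)) * f').
      apply: SmoothMul => //; apply: SmoothMul.
        by apply: SmoothBase; exact: smooth_cst.
      by apply: SmoothMul; apply: SmoothInv.
    move=> y Ay; rewrite /partial deriveV; [|exact: f0|exact: (df _ Ay).2].
    rewrite -/(partial i f y) Ef// -exprVn expr2.
    rewrite [RHS](_ : _ = -1 * ((f y)^-1 * (f y)^-1) * f' y)//.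
    by rewrite mulN1r.
Qed.

Lemma smoothD A f g : open A -> smooth_on A f -> smooth_on A g ->
  smooth_on A (fun y => f y + g y).
Proof. by move=> oA sf sg; apply: smooth_closureP => //; apply: SmoothAdd; exact: SmoothBase. Qed.

Lemma smoothM A f g : open A -> smooth_on A f -> smooth_on A g ->
  smooth_on A (fun y => f y * g y).
Proof. by move=> oA sf sg; apply: smooth_closureP => //; apply: SmoothMul; exact: SmoothBase. Qed.

Lemma smoothV A f : open A -> smooth_on A f -> (forall y, A y -> f y != 0) ->
  smooth_on A (fun y => (f y)^-1).
Proof. by move=> oA sf f0; apply: smooth_closureP => //; apply: SmoothInv => //; exact: SmoothBase. Qed.

Lemma smoothZ A (c : R) f : open A -> smooth_on A f ->
  smooth_on A (fun y => c * f y).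
Proof. by move=> oA sf; exact: (smoothM A (cst c) f oA (smooth_cst A c oA) sf). Qed.

Lemma smooth_sum A (I : Type) (r : seq I) (F : I -> 'rV[R]_n -> R) : open A ->
  (forall i, smooth_on A (F i)) -> smooth_on A (fun y => \sum_(i <- r) F i y).
Proof.
move=> oA sF; elim: r => [|i r ih].
  by under eq_fun do rewrite big_nil; exact: smooth_cst.
by under eq_fun do rewrite big_cons; exact: (smoothD _ _ _ oA (sF i) ih).
Qed.

Lemma smooth_ext A f g : open A -> (forall y, A y -> f y = g y) ->
  smooth_on A f -> smooth_on A g.
Proof.
move=> oA fg sf; apply: (@smooth_coind A [set h | exists2 k, smooth_on A k & forall y, A y -> k y = h y]) => //.
- move=> h [k sk kh] y Ay; have [ck dk] := sk [::] y Ay.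
  have nkh : \forall z \near y, k z = h z.
    by apply: filterS (near_open _ _ oA Ay) => z; exact: kh.
  split; last by move=> i; exact: near_eq_derivable (dk i).
  exact: near_eq_continuous nkh ck.
- move=> h i [k sk kh]; exists (partial i k).
    by exists (partial i k); [exact: smooth_partial|].
  move=> y Ay; apply/esym; apply: near_eq_derive.
  by apply: filterS (near_open _ _ oA Ay) => z; exact: kh.
- by exists f.
Qed.

Lemma open_nonzero : open [set y : 'rV[R]_n | y != 0].
Proof.
have -> : [set y : 'rV[R]_n | y != 0] = ~` [set 0].
  by apply/seteqP; split => y /= /eqP.
by apply: closed_openC; apply: accessible_closed_set1; apply: hausdorff_accessible; exact: norm_hausdorff.
Qed.

End Smooth.

(** * Positively homogeneous functions *)

Section PosHomogeneous.
Context {R : realType} {n : nat}.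
Implicit Types (f g : 'rV[R]_n -> R) (x y z v : 'rV[R]_n).

Lemma near_eq_cvg_to {T : Type} {U : topologicalType} {F : set_system T} {FF : Filter F}
    (f g : T -> U) (a b : U) :
  (\forall t \near F, g t = f t) -> f @ F --> a -> b = a -> g @ F --> b.
Proof.
move=> gf fa ->; apply: cvg_trans fa; apply: near_eq_cvg.
by apply: filterS gf => t ->.
Qed.

Lemma cvg_pair_cst {T : Type} (F : set_system T) {FF : Filter F} x y (f : T -> 'rV[R]_n) :
  f @ F --> y -> (fun t => (x, f t)) @ F --> (x, y).
Proof.
move=> fy; apply: (@cvg_pair _ _ _ F (nbhs x) (nbhs y) _ _ _ (fun=> x) f) => //.
exact: cvg_cst.
Qed.

Lemma line_continuous y x (c : R) : {for c, continuous (fun s : R => y + s *: x)}.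
Proof. by apply: cvgD; [exact: cvg_cst|apply: cvgZl; exact: cvg_id]. Qed.

Lemma sphere_compact : compact [set v : 'rV[R]_n | `|v| = 1].
Proof.
apply: bounded_closed_compact.
  by exists 1; split=> // M M1 v /= ->; exact: ltW.
apply: (@closed_comp _ _ (fun v : 'rV[R]_n => `|v|) [set 1]).
  by move=> v _; exact: norm_continuous.
by apply: accessible_closed_set1; apply: hausdorff_accessible; exact: norm_hausdorff.
Qed.

Lemma pos_homogeneous0 f : pos_homogeneous f -> f 0 = 0.
Proof.
move=> /(_ 2 0 (ltr0Sn R 1)); rewrite scaler0 => /eqP; rewrite mulr_natl mulr2n.
by rewrite -subr_eq subrr eq_sym => /eqP.
Qed.

(** At the origin, the bound [M] on the compact unit sphere becomes [|f v| <= M * |v|] by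
    homogeneity. *)
Lemma homogeneous_continuous f : pos_homogeneous f ->
  (forall y, y != 0 -> {for y, continuous f}) -> continuous f.
Proof.
move=> hf cf y; have [->|] := eqVneq y 0; last exact: cf.
have : bounded_set (f @` [set v : 'rV[R]_n | `|v| = 1]).
  apply: compact_bounded; apply: continuous_compact; last exact: sphere_compact.
  apply: continuous_in_subspaceT => v; rewrite inE/= => v1; apply: cf.
  by rewrite -normr_gt0 v1.
move=> /ex_strict_bound_gt0[M M0 fM].
have fb v : `|f v| <= M * `|v|.
  have [->|v0] := eqVneq v 0; first by rewrite pos_homogeneous0// !normr0 mulr0.
  have nv : 0 < `|v| by rewrite normr_gt0.
  rewrite -{1}(scale1r v) -(divff (lt0r_neq0 nv)) -scalerA hf//.
  rewrite normrM normr_id mulrC ler_wpM2r//; apply: ltW; apply: fM.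
  exists (`|v|^-1 *: v) => //=; rewrite normrZ ger0_norm ?invr_ge0// mulVf//.
  exact: lt0r_neq0.
apply/(@cvgrPdist_le _ _ _ (nbhs (0 : 'rV[R]_n)) _ f (f 0)) => e e0; rewrite pos_homogeneous0//; near=> v.
rewrite sub0r normrN (le_trans (fb v))//.
rewrite mulrC -ler_pdivlMr//; apply: ltW; near: v.
by apply: (@nbhs0_lt _ 'rV[R]_n); rewrite divr_gt0.
Unshelve. all: by end_near. Qed.

(** The factor [k] is separate from [a]: [k = a] serves functions of degree one, and [k = 1] their
    partial derivatives, whose homogeneity is known only off the origin, hence only near [y]. *)
Lemma homogeneous_derive f (k : R) (a : R) y v :
  (\forall z \near y, f (a *: z) = k * f z) -> differentiable f y ->
  differentiable f (a *: y) -> a * 'D_v f (a *: y) = k * 'D_v f y.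
Proof.
move=> hf dfy dfay.
have -> : k * 'D_v f y = 'D_v (k *: f) y by rewrite deriveZ//; exact: diff_derivable.
have -> : 'D_v (k *: f) y = 'D_v (f \o ( *:%R a)) y by apply: near_eq_derive; apply: filterS hf => z /= ->.
have ds : differentiable ( *:%R a) y by exact: (@ex_diff _ _ _ _ _ _ _ (is_diff_scaler a y)).
rewrite [RHS]deriveE; last exact: differentiable_comp.
have := @diff_comp _ _ _ _ ( *:%R a) f y ds dfay.
rewrite (@diff_val _ _ _ _ _ _ _ (is_diff_scaler a y)) => -> /=.
by rewrite deriveE// linearZ.
Qed.

(** Euler's relation for two degrees at once: [c = f z] in degree one, [c = 0] in degree zero. *)
Lemma euler_derive f z (c : R) :
  (forall a : R, 0 < a -> f (a *: z) = f z + (a - 1) * c) -> is_derive z z f c.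
Proof.
move=> hf.
suff L : (h^-1 *: ((f \o shift z) (h *: z) - f z)) @[h --> (0 : R)^'] --> c.
  by apply: DeriveDef; [apply/cvg_ex; exists c|exact: (cvg_lim (@Rhausdorff R) L)].
apply: cvg_near_cst; near=> h.
have h0 : h != 0 by near: h; exact: nbhs_dnbhs_neq.
have h1 : `|h| < 1 by near: h; exact: (@dnbhs0_lt _ R).
rewrite /= -{2}(scale1r z) -scalerDl hf.
  by rewrite addrK addrC addKr /GRing.scale/= mulKf.
by move: h1; rewrite ltr_norml => /andP[]; lra.
Unshelve. all: by end_near. Qed.

End PosHomogeneous.

(** * Bilinear forms of matrices *)

Section BilinearForm.
Context {R : realType} {n : nat}.
Implicit Types (f g : 'rV[R]_n -> R) (x y z v : 'rV[R]_n).

Lemma hessE f y i j : hessian f y i j = partial j (partial i f) y.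
Proof. by rewrite mxE. Qed.

Definition qf (H : 'M[R]_n) (u v : 'rV[R]_n) : R := (u *m H *m v^T) 0 0.

Lemma qfE (H : 'M[R]_n) u v : qf H u v = \sum_i \sum_j H i j * u 0 i * v 0 j.
Proof.
rewrite /qf mxE exchange_big/=; apply: eq_bigr => j _.
by rewrite !mxE mulr_suml; apply: eq_bigr => i _; rewrite [H i j * _]mulrC.
Qed.

Lemma qfDl (H : 'M[R]_n) u u' v : qf H (u + u') v = qf H u v + qf H u' v.
Proof. by rewrite /qf !mulmxDl mxE. Qed.

Lemma qfDr (H : 'M[R]_n) u v v' : qf H u (v + v') = qf H u v + qf H u v'.
Proof. by rewrite /qf linearD mulmxDr mxE. Qed.

Lemma qfZl (H : 'M[R]_n) (a : R) u v : qf H (a *: u) v = a * qf H u v.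
Proof. by rewrite /qf -!scalemxAl mxE. Qed.

Lemma qfZr (H : 'M[R]_n) (a : R) u v : qf H u (a *: v) = a * qf H u v.
Proof. by rewrite /qf linearZ/= -scalemxAr mxE. Qed.

Lemma qf_scale (k : R) (K : 'M[R]_n) u v : qf (k *: K) u v = k * qf K u v.
Proof. by rewrite /qf -scalemxAr -scalemxAl mxE. Qed.

Lemma qf_delta (H : 'M[R]_n) i j : qf H 'e_i 'e_j = H i j.
Proof. by rewrite /qf -rowE trmx_delta -colE !mxE. Qed.

Lemma qf_sym (H : 'M[R]_n) u v : H^T = H -> qf H u v = qf H v u.
Proof.
move=> HT; have E : (u *m H *m v^T)^T = v *m H *m u^T.
  by rewrite !trmx_mul trmxK HT mulmxA.
by rewrite /qf -E [RHS]mxE.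
Qed.

Lemma qf_radial (H : 'M[R]_n) z u v (a b : R) : H^T = H -> H *m z^T = 0 ->
  qf H (u + a *: z) (v + b *: z) = qf H u v.
Proof.
move=> HT Hz.
have q0 w : qf H w z = 0 by rewrite /qf -mulmxA Hz mulmx0 mxE.
by rewrite qfDl !qfDr !qfZl !qfZr ![qf H z _]qf_sym// !q0 !mulr0 !addr0.
Qed.

Lemma qf_conj (M K : 'M[R]_n) u v :
  qf (M *m K *m M^T) u v = qf K (u *m M) (v *m M).
Proof. by rewrite /qf trmx_mul !mulmxA. Qed.

(** With [p] the gradient of [Phi x], this is the differential of [y + Phi x y *: x] acting on row
    vectors. *)
Lemma mul_row_dotp (p x u : 'rV[R]_n) :
  u *m (1%:M + p^T *m x) = u + dotp p u *: x.
Proof.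
rewrite mulmxDr mulmx1 mulmxA; congr (_ + _).
rewrite -mul_scalar_mx; congr (_ *m _).
apply/matrixP => i j; rewrite !ord1 !mxE eqxx mulr1n.
by apply: eq_bigr => k _; rewrite mxE mulrC.
Qed.

Lemma cvg_qf {T : Type} {F : set_system T} {FF : Filter F}
  (K : T -> 'M[R]_n) (K0 : 'M[R]_n) (u v : T -> 'rV[R]_n) u0 v0 :
  (forall i j, K t i j @[t --> F] --> K0 i j) -> u @ F --> u0 -> v @ F --> v0 ->
  qf (K t) (u t) (v t) @[t --> F] --> qf K0 u0 v0.
Proof.
move=> cK cu cv; rewrite qfE; under eq_cvg do rewrite qfE.
apply: cvg_big => [|i _]; first exact: add_continuous.
apply: cvg_big => [|j _]; first exact: add_continuous.
apply: cvgM; first apply: cvgM; first exact: cK.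
- by apply: (@cvg_comp _ _ _ u (fun M : 'rV_n => M 0 i) _ _ _ cu); exact: coord_continuous.
- by apply: (@cvg_comp _ _ _ v (fun M : 'rV_n => M 0 j) _ _ _ cv); exact: coord_continuous.
Qed.

Lemma dotp_delta (a : 'rV[R]_n) i : dotp a 'e_i = a 0 i.
Proof.
rewrite /dotp (bigD1 i)//= big1 => [|j ji]; rewrite mxE !eqxx/= ?mulr1 ?addr0//.
by rewrite (negPf ji) mulr0.
Qed.

Lemma dotpZl (k : R) (g w : 'rV[R]_n) : dotp (k *: g) w = k * dotp g w.
Proof. by rewrite /dotp mulr_sumr; apply: eq_bigr => i _; rewrite mxE mulrA. Qed.

End BilinearForm.

(** * Euler relations for homogeneous functions smooth off the origin *)

Section PuncturedSmooth.
Context {R : realType} {n : nat}.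
Implicit Types (f g : 'rV[R]_n -> R) (x y z v : 'rV[R]_n).
Local Notation nz := [set y : 'rV[R]_n | y != 0].
Variable G : 'rV[R]_n -> R.
Hypothesis G_smooth : smooth_on nz G.
Hypothesis G_hom : pos_homogeneous G.

Lemma punctured_continuous : continuous G.
Proof. by apply: homogeneous_continuous => // y y0; exact: (G_smooth [::] y y0).1. Qed.

Lemma punctured_diff z : z != 0 -> differentiable G z.
Proof. by move=> z0; exact: (smooth_diff nz G z open_nonzero G_smooth z0).1. Qed.

Lemma punctured_derive z v : z != 0 -> 'D_v G z = dotp (grad G z) v.
Proof. by move=> z0; exact: (smooth_derive nz G z v open_nonzero G_smooth z0). Qed.

Lemma grad_cont z : z != 0 -> {for z, continuous (grad G)}.
Proof.
move=> z0; apply: (@cvg_row _ _ _ (nbhs z)) => i.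
under eq_cvg do rewrite mxE; rewrite mxE.
exact: (G_smooth [:: i] z z0).1.
Qed.

Lemma dotp_grad_cont z v : z != 0 ->
  {for z, continuous (fun z => dotp (grad G z) v)}.
Proof.
move=> z0.
exact: (@cvg_dotp _ _ _ (nbhs z) _ (grad G) (fun=> v) _ _ (grad_cont z z0) (cvg_cst v)).
Qed.

Lemma grad_homogeneous z i (a : R) : 0 < a -> z != 0 ->
  partial i G (a *: z) = partial i G z.
Proof.
move=> a0 z0; have az0 : a *: z != 0 by rewrite scaler_eq0 negb_or z0 lt0r_neq0.
apply: (mulfI (lt0r_neq0 a0)).
apply: homogeneous_derive; [|exact: punctured_diff|exact: punctured_diff].
by apply: (@filterE _ (nbhs z)) => w; exact: G_hom.
Qed.

Lemma grad_euler z : z != 0 -> dotp (grad G z) z = G z.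
Proof.
move=> z0; rewrite -punctured_derive//.
have [|_ //] := @euler_derive R n G z (G z).
by move=> a a0; rewrite G_hom//; ring.
Qed.

Lemma derive_partial i z v : z != 0 -> 'D_v (partial i G) z = (hessian G z *m v^T) i 0.
Proof.
move=> z0; rewrite (smooth_derive nz _ z v open_nonzero _ z0); last exact: smooth_partial.
by rewrite /dotp mxE; apply: eq_bigr => k _; rewrite !mxE.
Qed.

Lemma diff_partial i z : z != 0 -> differentiable (partial i G) z.
Proof.
move=> z0; apply: (smooth_diff nz _ z open_nonzero _ z0).1; exact: smooth_partial.
Qed.

Lemma grad_is_derive z x w : z != 0 ->
  is_derive z w (fun z => dotp (grad G z) x) (qf (hessian G z) x w).
Proof.
move=> z0.
have -> : (fun z => dotp (grad G z) x) = \sum_(l < n) (x 0 l *: partial l G).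
  apply/funext => t; rewrite fct_sumE.
  by apply: eq_bigr => l _; rewrite mxE mulrC.
have -> : qf (hessian G z) x w = \sum_(l < n) x 0 l *: 'D_w (partial l G) z.
  rewrite /qf -mulmxA mxE; apply: eq_bigr => l _.
  by rewrite derive_partial.
apply: is_derive_sum => l; apply: is_deriveZ.
by apply: derivableP; apply: diff_derivable; exact: diff_partial.
Qed.

Lemma hess_euler z : z != 0 -> hessian G z *m z^T = 0.
Proof.
move=> z0; apply/matrixP => i j; rewrite ord1 -derive_partial// mxE.
have [|_ //] := @euler_derive R n (partial i G) z 0.
by move=> a a0; rewrite grad_homogeneous// mulr0 addr0.
Qed.

Lemma hess_homogeneous z (a : R) : 0 < a -> z != 0 ->
  a *: hessian G (a *: z) = hessian G z.
Proof.
move=> a0 z0; have az0 : a *: z != 0 by rewrite scaler_eq0 negb_or z0 lt0r_neq0.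
apply/matrixP => i j.
apply: (etrans (mxE _ _ _ _)); apply: (etrans (congr1 ( *%R a) (hessE G (a *: z) i j))).
apply: (etrans _ (esym (hessE G z i j))).
apply: (etrans _ (mul1r (partial j (partial i G) z))).
apply: homogeneous_derive; [|exact: diff_partial|exact: diff_partial].
apply: filterS (near_open _ _ open_nonzero z0) => w w0.
by rewrite mul1r grad_homogeneous.
Qed.

Lemma hess_sym z : z != 0 -> (hessian G z)^T = hessian G z.
Proof.
move=> z0; apply/matrixP => i j; rewrite !mxE.
exact: (smooth_schwarz nz G z j i open_nonzero G_smooth z0).
Qed.

End PuncturedSmooth.

(** * The equation s = G(y + s x) *)

Section Implicit.
Context {R : realType} {n : nat}.
Implicit Types (f g : 'rV[R]_n -> R) (x y z v : 'rV[R]_n).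
Local Notation nz := [set y : 'rV[R]_n | y != 0].
(** One argument serves both equations: [A] is always [phi + psi], which is subadditive and cuts out
    [Omega], while [G] is [phi + psi] or [phi - psi] and need not be convex. *)
Variables (A G : 'rV[R]_n -> R) (Phi : 'rV[R]_n -> 'rV[R]_n -> R).
Hypothesis A_hom : pos_homogeneous A.
Hypothesis A_ge0 : forall y, 0 <= A y.
Hypothesis A_sub : forall y z, A (y + z) <= A y + A z.
Hypothesis A_cont : continuous A.
Hypothesis G_smooth : smooth_on nz G.
Hypothesis G_hom : pos_homogeneous G.
Hypothesis G_le : forall y, G y <= A y.
Local Notation W x := (A x < 1).
Hypothesis PhiP : forall x y, W x -> unique (fun s : R => s = G (y + s *: x)) (Phi x y).

Lemma PhiE x y : W x -> Phi x y = G (y + Phi x y *: x).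
Proof. by move=> /PhiP-/(_ y)[]. Qed.

Lemma Phi_eq x y s : W x -> s = G (y + s *: x) -> Phi x y = s.
Proof. by move=> /PhiP-/(_ y)[_]; apply. Qed.

(* Uniqueness of the solution at all the base points [y + c x] makes
   [s |-> s - G (y + s x)] injective; it tends to [+oo] at [+oo] since [G <= A]. *)
Lemma shift_increasing x y (a b : R) : W x -> a < b ->
  a - G (y + a *: x) < b - G (y + b *: x).
Proof.
move=> Wx ab; pose g (s : R) : R := s - G (y + s *: x).
have ginj s t : g s = g t -> s = t.
  move=> gst.
  (* If [g r = g s], then [r - g s] solves the equation at the base point [y + g s *: x], because
     that point shifted by [(r - g s) *: x] is [y + r *: x]. *)
  have key r : g r = g s -> Phi x (y + g s *: x) = r - g s.
    move=> <-; apply: Phi_eq => //.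
    by rewrite -addrA -scalerDl addrCA subrr addr0 /g subKr.
  have := key s erefl; rewrite (key t (esym gst)) => /eqP.
  by rewrite (can_eq (subrK _)) eq_sym => /eqP.
have gc : continuous g.
  move=> s; apply: cvgB; first exact: cvg_id.
  by apply: (@cvg_comp _ _ _ (fun s : R => y + s *: x) G);
    [exact: line_continuous|exact: (punctured_continuous G G_smooth G_hom)].
rewrite -/(g a) -/(g b) ltNge; apply/negP => gba.
have Ax0 : 0 < 1 - A x by rewrite subr_gt0.
(* Chosen so that [c * (1 - A x) >= |g a| + A y]; since [G (y + c *: x) <= A y + c * A x], this
   gives [g c >= g a], and also [c >= b]. *)
pose c : R := 1 + `|b| + (`|g a| + A y) / (1 - A x).
have c_ge0 : 0 <= (`|g a| + A y) / (1 - A x).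
  by apply: divr_ge0; [apply: addr_ge0|exact: ltW].
have bc : b <= c.
  have := ler_norm b; rewrite /c; move: c_ge0; move: (_ / _) `|b| => *; lra.
have c0 : 0 < c by rewrite /c; move: c_ge0 (normr_ge0 b); move: (_ / _) `|b| => *; lra.
have gac : g a <= g c.
  have Gc : G (y + c *: x) <= A y + c * A x.
    by rewrite (le_trans (G_le _))// (le_trans (A_sub _ _))// A_hom.
  have e : c * (1 - A x) = (1 + `|b|) * (1 - A x) + (`|g a| + A y).
    by rewrite /c mulrDl divfK// lt0r_neq0.
  have : 0 <= (1 + `|b|) * (1 - A x) by apply: mulr_ge0; [apply: addr_ge0|exact: ltW].
  have := ler_norm (g a); rewrite [g c]/g; move: Gc e.
  move: ((1 + `|b|) * (1 - A x)) (G (y + c *: x)) => k G1.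
  move: c {bc c0} `|g a| (g a) {gba} => c' nga ga; lra.
(* With [g b <= g a <= g c], the value [g a] is taken again on [[b, c]], against injectivity and
   [a < b]. *)
have [d /[!in_itv]/= /andP[bd _] gd] := @IVT R g b c (g a) bc
  (continuous_subspaceT gc) ltac:(by rewrite ge_min gba le_max gac orbT).
by move: (ginj _ _ gd) bd => ->; rewrite leNgt ab.
Qed.

(* Strictness comes from monotonicity at [l *: x] for some [l > 1] with [A (l *: x) < 1]. *)
Lemma dG_lt1 x z : W x -> z != 0 -> dotp (grad G z) x < 1.
Proof.
move=> Wx z0; have A1 : 0 < 1 + A x by rewrite ltr_wpDr.
(* As [A x < 1], both [l > 1] and [A (l *: x) = 2 A x / (1 + A x) < 1]; monotonicity along [l *: x]
   yields [dG(z) x <= 1 / l]. *)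
pose l := 2 / (1 + A x).
have l0 : 0 < l by rewrite divr_gt0.
have Wl : W (l *: x).
  by rewrite A_hom// /l mulrAC ltr_pdivrMr// mul1r; move: Wx; lra.
pose g (t : R) : R := t - G (z + t *: (l *: x)).
have gd : is_derive (0 : R) (1 : R) g (1 - dotp (grad G z) (l *: x)).
  apply: is_deriveB; have -> : dotp (grad G z) (l *: x) = 'D_(l *: x) G (z + 0 *: (l *: x)).
    by rewrite scale0r addr0 (punctured_derive G G_smooth).
  apply: is_derive_line; rewrite scale0r addr0.
  by apply: diff_derivable; exact: (punctured_diff G G_smooth).
have ge0 : 0 <= 1 - dotp (grad G z) (l *: x).
  have [dg <-] := gd; rewrite /derive; apply: limr_ge => //; near=> h.
  have h0 : h != 0 by near: h; exact: nbhs_dnbhs_neq.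
  rewrite /= addr0 [_%:A]mulr1 /GRing.scale/=.
  have [hp|hn] := ltP 0 h.
    by rewrite mulr_ge0 ?invr_ge0 ?(ltW hp)// subr_ge0 ltW// /g shift_increasing.
  rewrite mulr_le0 ?invr_le0// subr_le0 ltW// /g shift_increasing//.
  by rewrite lt_neqAle h0.
move: ge0; rewrite linearZ/= subr_ge0 /l /GRing.scale/= => ge0.
rewrite -(ltr_pM2l l0).
apply: (le_lt_trans ge0); rewrite mulr1 /l ltr_pdivlMr// mul1r; move: Wx; lra.
Unshelve. all: by end_near. Qed.

(** [s - G(y + s x)] is negative at [Phi x0 y0 - e] and positive at [Phi x0 y0 + e]. Both signs
    persist for nearby [(x, y)], and monotonicity puts the root in between. *)
Lemma Phi_cont x0 y0 : W x0 ->
  {for (x0, y0), continuous (fun p : 'rV[R]_n * 'rV[R]_n => Phi p.1 p.2)}.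
Proof.
move=> Wx0; apply/(@cvgrPdist_lt _ _ _ (nbhs (x0, y0)) _ _ (Phi x0 y0)) => e e0.
pose h (c : R) (p : 'rV[R]_n * 'rV[R]_n) : R := c - G (p.2 + c *: p.1).
have hc c : h c p @[p --> (x0, y0)] --> h c (x0, y0).
  apply: cvgB; first exact: cvg_cst.
  apply: (@cvg_comp _ _ _ (fun p : 'rV[R]_n * 'rV[R]_n => p.2 + c *: p.1) G); last exact: (punctured_continuous G G_smooth G_hom).
  by apply: cvgD; [exact: cvg_snd|apply: cvgZr; exact: cvg_fst].
have h0 p : W p.1 -> h (Phi p.1 p.2) p = 0.
  by move=> Wp; rewrite /h -PhiE// subrr.
have hlt c d p : W p.1 -> c < d -> h c p < h d p by move=> Wp; exact: shift_increasing.
near=> p.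
have Wp : W p.1.
  near: p; apply: (@cvgr_lt _ _ _ _ (fun p : 'rV[R]_n * 'rV[R]_n => A p.1) (A x0)) => //.
  by apply: (@cvg_comp _ _ _ fst A); [exact: cvg_fst|exact: A_cont].
have hp : 0 < h (Phi x0 y0 + e) p.
  near: p; apply: (@cvgr_gt _ _ _ _ (h (Phi x0 y0 + e)) _ (hc _)).
  by rewrite -(h0 (x0, y0) Wx0); apply: hlt => //; rewrite ltrDl.
have hm : h (Phi x0 y0 - e) p < 0.
  near: p; apply: (@cvgr_lt _ _ _ _ (h (Phi x0 y0 - e)) _ (hc _)).
  by rewrite -[ltRHS](h0 (x0, y0) Wx0); apply: hlt => //; rewrite ltrBlDr ltrDl.
have hle c d : c <= d -> h c p <= h d p.
  by rewrite le_eqVlt => /predU1P[->//|/(hlt _ _ _ Wp)/ltW].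
rewrite distrC ltr_distl; apply/andP; split; rewrite ltNge; apply/negP => /hle.
  by rewrite h0// => /le_lt_trans/(_ hm); rewrite ltxx.
by rewrite h0// => /(lt_le_trans hp); rewrite ltxx.
Unshelve. all: by end_near. Qed.

Definition foot x y := y + Phi x y *: x.

Lemma foot_neq0 x y : W x -> y != 0 -> foot x y != 0.
Proof.
move=> Wx; apply: contra => /eqP z0; have := PhiE x y Wx.
rewrite -/(foot x y) z0 pos_homogeneous0// => Phi0.
by move: z0; rewrite /foot Phi0 scale0r addr0 => ->.
Qed.

Lemma foot_cont x0 y0 : W x0 ->
  {for (x0, y0), continuous (fun p : 'rV[R]_n * 'rV[R]_n => foot p.1 p.2)}.
Proof.
move=> Wx0; apply: cvgD; first exact: cvg_snd.
by apply: cvgZ; [exact: Phi_cont|exact: cvg_fst].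
Qed.

Lemma foot_contr x y : W x -> {for y, continuous (foot x)}.
Proof.
move=> Wx; apply: (@cvg_comp _ _ _ (fun y => (x, y)) (fun p => foot p.1 p.2)); last exact: foot_cont.
by apply: (@cvg_pair_cst _ _ _ (nbhs y) _ x y id); exact: cvg_id.
Qed.

(* By the mean value theorem the difference quotient of [Phi x] equals
   [dG(xi) v / (1 - dG(xi) x)] at a point [xi] close to [foot x y]. *)
Lemma Phi_is_derive x y v : W x -> y != 0 ->
  is_derive y v (Phi x) (dotp (grad G (foot x y)) v / (1 - dotp (grad G (foot x y)) x)).
Proof.
move=> Wx y0; have z0 := foot_neq0 x y Wx y0.
pose K z := dotp (grad G z) v / (1 - dotp (grad G z) x).
have Kc : {for foot x y, continuous K}.
  apply: (@continuousM R _ (fun z => dotp (grad G z) v) (fun z => (1 - dotp (grad G z) x)^-1)).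
    exact: (dotp_grad_cont G G_smooth).
  apply: (@continuousV R _ (fun z => 1 - dotp (grad G z) x)).
    by rewrite lt0r_neq0// subr_gt0 dG_lt1.
  by apply: (@continuousB R R _ (cst 1) (fun z => dotp (grad G z) x));
    [exact: cst_continuous|exact: (dotp_grad_cont G G_smooth)].
suff L : (h^-1 *: ((Phi x \o shift y) (h *: v) - Phi x y)) @[h --> (0 : R)^'] --> K (foot x y).
  by apply: DeriveDef; [apply/cvg_ex; exists (K (foot x y))|exact: (cvg_lim (@Rhausdorff R) L)].
apply/cvgrPdist_le => e e0.
have /(@nbhs_ballP _ 'rV[R]_n)[r /= r0 hr] : nbhs (foot x y) [set z | z != 0 /\ `|K (foot x y) - K z| <= e].
  apply: filterI; first exact: (near_open _ _ open_nonzero z0).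
  by move/(@cvgrPdist_le _ _ _ (nbhs (foot x y)) _ K): Kc; apply.
have cz : foot x (h *: v + y) @[h --> (0 : R)^'] --> foot x y.
  apply: (@cvg_comp _ _ _ (fun h : R => h *: v + y) (foot x) _ (nbhs y)); last exact: foot_contr.
  apply: cvg_within_filter.
  have -> : (fun h : R => h *: v + y) = (fun h : R => y + h *: v) by apply/funext => h; rewrite addrC.
  by have := line_continuous y v 0; rewrite /prop_for /continuous_at scale0r addr0.
near=> h.
have h0 : h != 0 by near: h; exact: nbhs_dnbhs_neq.
have zb : `|foot x y - foot x (h *: v + y)| < r.
  by near: h; move/cvgrPdist_lt : cz; exact.
have zzE : foot x (h *: v + y) - foot x y = h *: v + (Phi x (h *: v + y) - Phi x y) *: x.
  by rewrite /foot scalerBl opprD !addrA; congr (_ - _); rewrite addrAC addrK.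
have inb t : `|t| <= `|(1 : R)| -> ball (foot x y) r (foot x y + t *: (foot x (h *: v + y) - foot x y)).
  rewrite normr1 -ball_normE /ball_/= opprD addrA subrr sub0r normrN normrZ => t1.
  by apply: le_lt_trans zb; rewrite distrC -[leRHS]mul1r ler_wpM2r.
have [t t1] := MVT_line G (foot x y) (foot x (h *: v + y) - foot x y) 1
  (fun t ht => diff_derivable ((punctured_diff G G_smooth) _ (hr _ (inb t ht)).1)).
have [xi0 Kxi] := hr _ (inb t t1); move: Kxi xi0.
rewrite scale1r addrCA subrr addr0 mul1r -!PhiE//.
move: (foot x y + t *: _) => xi Kxi xi0 E.
rewrite (punctured_derive G G_smooth)// zzE linearD !linearZ/= in E; move: E; rewrite /GRing.scale/=.
move: (Phi x (h *: v + y) - Phi x y) => d E.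
(* [E] reads [d = h * dG(xi) v + d * dG(xi) x], to be solved for the increment [d] of [Phi x]. *)
have d0 : 1 - dotp (grad G xi) x != 0 by rewrite lt0r_neq0// subr_gt0 dG_lt1.
have <- // : K xi = h^-1 * d.
apply: (mulfI h0); rewrite mulVKf//.
apply: (mulIf d0); rewrite /K -!mulrA mulVf// mulr1 mulrBr mulr1.
by rewrite {1}E addrK.
Unshelve. all: by end_near. Qed.

Lemma Phi_partial x y i : W x -> y != 0 ->
  partial i (Phi x) y = partial i G (foot x y) / (1 - dotp (grad G (foot x y)) x).
Proof.
by move=> Wx y0; have [_] := Phi_is_derive x y 'e_i Wx y0; rewrite dotp_delta mxE.
Qed.

Lemma smooth_den x : W x -> smooth_on nz (fun z => (1 - dotp (grad G z) x)^-1).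
Proof.
move=> Wx; apply: smoothV; first exact: open_nonzero.
  apply: (smooth_ext nz (fun z => 1 + \sum_i partial i G z * - x 0 i)) => [|z _|].
  - exact: open_nonzero.
  - rewrite /dotp -sumrN; congr (_ + _); apply: eq_bigr => i _.
    by rewrite mxE mulrN.
  - apply: smoothD; [exact: open_nonzero|apply: smooth_cst; exact: open_nonzero|].
    apply: smooth_sum; first exact: open_nonzero.
    move=> i; apply: smoothM; [exact: open_nonzero|exact: smooth_partial|].
    by apply: smooth_cst; exact: open_nonzero.
by move=> z z0; rewrite lt0r_neq0// subr_gt0 dG_lt1.
Qed.

(** The partial derivative of [Phi x] seen as a function of the foot: it involves [G] alone, which
    lets smoothness bootstrap. *)
Let slope x i z := partial i G z / (1 - dotp (grad G z) x).

Lemma smooth_slope x i : W x -> smooth_on nz (slope x i).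
Proof.
move=> Wx; apply: smoothM; [exact: open_nonzero|exact: smooth_partial|].
exact: smooth_den.
Qed.

Lemma cont_comp_foot f x y : W x -> y != 0 -> smooth_on nz f ->
  {for y, continuous (fun y => f (foot x y))}.
Proof.
move=> Wx y0 sf; apply: (@cvg_comp _ _ _ (foot x) f _ (nbhs (foot x y))).
  exact: foot_contr.
exact: (sf [::] _ (foot_neq0 x y Wx y0)).1.
Qed.

Lemma Phi_diff x y : W x -> y != 0 ->
  differentiable (Phi x) y /\ 'd (Phi x) y = dotp (grad (Phi x) y) :> (_ -> _).
Proof.
move=> Wx y0; have nyz := near_open _ _ open_nonzero y0.
apply: C1_diff => i.
  by apply: filterS nyz => z z0; have [] := Phi_is_derive x z 'e_i Wx z0.
apply: near_eq_continuous (cont_comp_foot (slope x i) x y Wx y0 (smooth_slope x i Wx)).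
by apply: filterS nyz => z z0; rewrite Phi_partial.
Qed.

Lemma derive_comp_foot f x y v : W x -> y != 0 -> smooth_on nz f ->
  is_derive y v (fun y => f (foot x y)) ('D_(v + dotp (grad (Phi x) y) v *: x) f (foot x y)).
Proof.
move=> Wx y0 sf; have [dP dPE] := Phi_diff x y Wx y0.
have z0 := foot_neq0 x y Wx y0.
have dfoot : differentiable (foot x) y.
  by apply: differentiableD => //; exact: differentiableZl.
have df := (smooth_diff nz f _ open_nonzero sf z0).1.
have dcomp : differentiable (f \o foot x) y by exact: differentiable_comp.
apply: DeriveDef; first exact: diff_derivable.
rewrite -[LHS]/('D_v (f \o foot x) y) [LHS]deriveE// diff_comp//= deriveE//.
congr ('d f _ _).
have E1 := @diffD R _ _ id (fun y => Phi x y *: x) y (@ex_diff _ _ _ _ _ _ _ (is_diff_id y))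
  (differentiableZl x dP).
have E2 := congr1 (@^~ v) (@diffZl _ _ _ (Phi x) x y dP).
have E3 := congr1 (@^~ v) (@diff_val _ _ _ _ _ _ _ (is_diff_id y)).
have E4 := congr1 (@^~ v) dPE.
apply: (etrans (congr1 (@^~ v) E1)); apply: (etrans (congr2 +%R E3 E2)).
by congr (_ + _ *: _).
Qed.

(** Coinduction on the compositions of [foot x] with functions smooth off the origin:
    differentiating [foot x] only produces [slope x] at the foot, so the class is stable. The case
    [f = G] is the smoothness of [Phi x]. *)
Lemma smooth_comp_foot f x : W x -> smooth_on nz f -> smooth_on nz (fun y => f (foot x y)).
Proof.
move=> Wx sf.
apply: (@smooth_coind _ _ nz [set g | exists2 f, smooth_on nz f & g = fun y => f (foot x y)]).
- exact: open_nonzero.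
- move=> _ [{sf}f sf ->] y y0; split; first exact: cont_comp_foot.
  by move=> i; have [] := derive_comp_foot f x y 'e_i Wx y0 sf.
- move=> _ i [{sf}f sf ->].
  exists (fun y => partial i f (foot x y) + slope x i (foot x y) * \sum_k partial k f (foot x y) * x 0 k).
    exists (fun z => partial i f z + slope x i z * \sum_k partial k f z * x 0 k); [|by []].
    apply: smoothD; [exact: open_nonzero|exact: smooth_partial|].
    apply: smoothM; [exact: open_nonzero|exact: smooth_slope|].
    apply: smooth_sum => [|k]; first exact: open_nonzero.
    apply: smoothM; [exact: open_nonzero|exact: smooth_partial|].
    by apply: smooth_cst; exact: open_nonzero.
  move=> y y0; have [_] := derive_comp_foot f x y 'e_i Wx y0 sf.
  rewrite /partial => ->; rewrite (smooth_derive nz _ _ _ open_nonzero sf (foot_neq0 x y Wx y0)).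
  rewrite linearD linearZ/= !dotp_delta !mxE Phi_partial//; congr (_ + _ * _).
  by apply: eq_bigr => k _; rewrite !mxE.
- by exists f.
Qed.

Lemma Phi_smooth x : W x -> smooth_on nz (Phi x).
Proof.
move=> Wx; apply: (smooth_ext nz (fun y => G (foot x y))) (smooth_comp_foot G x Wx G_smooth).
  exact: open_nonzero.
by move=> y _; rewrite -PhiE.
Qed.

Lemma Phi_grad x y : W x -> y != 0 ->
  grad (Phi x) y = (1 - dotp (grad G (foot x y)) x)^-1 *: grad G (foot x y).
Proof. by move=> Wx y0; apply/rowP => i; rewrite !mxE Phi_partial// mulrC. Qed.

Lemma Phi_hess x y u v : W x -> y != 0 ->
  qf (hessian (Phi x) y) u v = (1 - dotp (grad G (foot x y)) x)^-1 *
   qf (hessian G (foot x y)) (u + dotp (grad (Phi x) y) u *: x)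
                           (v + dotp (grad (Phi x) y) v *: x).
Proof.
move=> Wx y0; have z0 := foot_neq0 x y Wx y0.
set z := foot x y in z0 *; set c := (1 - _)^-1; set p := grad (Phi x) y.
have den_derive w : is_derive z w (fun z => 1 - dotp (grad G z) x) (- qf (hessian G z) x w).
  rewrite -[X in is_derive _ _ _ X]sub0r.
  have -> : (fun z => 1 - dotp (grad G z) x) = cst 1 - (fun z => dotp (grad G z) x) by [].
  by apply: is_deriveB; exact: (grad_is_derive G G_smooth).
have den0 : 1 - dotp (grad G z) x != 0 by rewrite lt0r_neq0// subr_gt0 dG_lt1.
(* Quotient rule; the derivative of the denominator contributes the term [p 0 i *: x]. *)
have slope_derive i w : 'D_w (slope x i) z = c * qf (hessian G z) ('e_i + p 0 i *: x) w.
  have [dd dE] := den_derive w.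
  rewrite /slope deriveM; last 2 first.
  - by apply: diff_derivable; exact: (diff_partial G G_smooth).
  - exact: derivableV.
  rewrite deriveV// dE (derive_partial G G_smooth)// qfDl qfZl /p Phi_grad// -/z -/c.
  have -> : (hessian G z *m w^T) i 0 = qf (hessian G z) 'e_i w.
    by rewrite /qf -rowE -row_mul !mxE.
  move: (qf _ x w) (qf _ 'e_i w) => a b; rewrite !mxE /GRing.scale/=.
  have -> : (1 - dotp (grad G z) x) ^- 2 = c * c by rewrite -expr2 exprVn.
  rewrite -/c; move: c (partial i G z) => c' g; ring.
have -> : hessian (Phi x) y = c *: ((1%:M + p^T *m x) *m hessian G z *m (1%:M + p^T *m x)^T); last first.
  have -> M : qf (c *: M) u v = c * qf M u v by rewrite /qf -scalemxAr -scalemxAl mxE.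
  by rewrite qf_conj !mul_row_dotp.
apply/matrixP => i j; rewrite hessE.
rewrite [RHS]mxE -(qf_delta (_ *m _ *m _)) qf_conj !mul_row_dotp !dotp_delta.
rewrite -slope_derive.
have [_] := derive_comp_foot (slope x i) x y 'e_j Wx y0 (smooth_slope x i Wx).
rewrite dotp_delta; apply: etrans; apply: near_eq_derive.
by apply: filterS (near_open _ _ open_nonzero y0) => w w0; rewrite Phi_partial.
Qed.

(** With [s = Phi x y], Euler's relation gives [dG(z) y = s - s dG(z) x], so the denominator at
    [x + t *: y] factors. By [dG_lt1] it is positive at both points, hence [1 - t s > 0] and the
    rescaled [z] is the foot of the new equation. *)
Lemma Phi_line x y t : W x -> W (x + t *: y) -> y != 0 ->
  [/\ 0 < 1 - t * Phi x y, foot (x + t *: y) y = (1 - t * Phi x y)^-1 *: foot x y,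
      1 - dotp (grad G (foot x y)) (x + t *: y) =
        (1 - dotp (grad G (foot x y)) x) * (1 - t * Phi x y)
    & Phi (x + t *: y) y = (1 - t * Phi x y)^-1 * Phi x y].
Proof.
move=> Wx Wx' y0; have z0 := foot_neq0 x y Wx y0.
set z := foot x y in z0 *; set s := Phi x y.
have gy : dotp (grad G z) y = s - s * dotp (grad G z) x.
  have -> : y = z - s *: x by rewrite /z /foot addrK.
  by rewrite linearB linearZ/= (grad_euler G G_smooth G_hom)// -PhiE.
have E : 1 - dotp (grad G z) (x + t *: y) = (1 - dotp (grad G z) x) * (1 - t * s).
  rewrite linearD linearZ/= gy /GRing.scale/=; ring.
have den : 0 < 1 - dotp (grad G z) x by rewrite subr_gt0 dG_lt1.
have ts : 0 < 1 - t * s.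
  by rewrite -(pmulr_rgt0 _ den) -E subr_gt0 dG_lt1.
have tsi : 0 < (1 - t * s)^-1 by rewrite invr_gt0.
have zE : y + ((1 - t * s)^-1 * s) *: (x + t *: y) = (1 - t * s)^-1 *: z.
  apply/rowP => i; rewrite /z /foot -/s !mxE.
  by move: (y 0 i) (x 0 i) s ts {E gy tsi} => yi xi s' ts'; field; exact: lt0r_neq0.
have P : Phi (x + t *: y) y = (1 - t * s)^-1 * s.
  apply: Phi_eq => //; rewrite zE G_hom//; congr (_ * _).
  by rewrite -PhiE.
by split => //; rewrite /foot P zE.
Qed.

(* The Hessian of [Phi x] at [y], expressed through the data of [G] at [foot x y]:
   [c] is [1 / (1 - dG x)], [g] the gradient and [K] the Hessian of [G]. *)
Definition hess_form (c : R) (g : 'rV[R]_n) (K : 'M[R]_n) x u v : R :=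
  c * qf K (u + dotp (c *: g) u *: x) (v + dotp (c *: g) v *: x).

Lemma Phi_hess_form x y z (c : R) (g : 'rV[R]_n) (K : 'M[R]_n) (u v : 'rV[R]_n) : W x -> y != 0 ->
  foot x y = z -> (1 - dotp (grad G z) x)^-1 = c -> grad G z = g -> hessian G z = K ->
  qf (hessian (Phi x) y) u v = hess_form c g K x u v.
Proof.
move=> Wx y0 <- <- <- <-; rewrite /hess_form.
by have := Phi_hess x y u v Wx y0; rewrite Phi_grad.
Qed.

(** The factor [1 - t s] gained by [K] cancels the one in [c], and the vectors inserted in the form
    change by multiples of [y + s *: x], which [K] annihilates. *)
Lemma hess_form_line (c s t : R) (g : 'rV[R]_n) (K : 'M[R]_n) x y u v :
  K^T = K -> K *m (y + s *: x)^T = 0 -> 1 - t * s != 0 ->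
  hess_form (c * (1 - t * s)^-1) g ((1 - t * s) *: K) (x + t *: y) u v =
  hess_form c g K x u v.
Proof.
move=> KT Kz ts.
have vE w : w + dotp ((c * (1 - t * s)^-1) *: g) w *: (x + t *: y) =
    (w + dotp (c *: g) w *: x) +
    (dotp (c *: g) w * t * (1 - t * s)^-1) *: (y + s *: x).
  rewrite !dotpZl; apply/rowP => i; rewrite !mxE.
  move: (y 0 i) (x 0 i) (w 0 i) (dotp g w) => yi xi wi d.
  by field.
rewrite /hess_form !vE qf_scale mulrA -[c * _ * _]mulrA mulVf// mulr1; congr (_ * _).
exact: qf_radial.
Qed.

Lemma hess_line_invariance x y t u v : W x -> W (x + t *: y) -> y != 0 ->
  qf (hessian (Phi (x + t *: y)) y) u v = qf (hessian (Phi x) y) u v.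
Proof.
move=> Wx Wx' y0; have z0 := foot_neq0 x y Wx y0.
have [ts zE dE _] := Phi_line x y t Wx Wx' y0.
have tsi : 0 < (1 - t * Phi x y)^-1 by rewrite invr_gt0.
have gE : grad G ((1 - t * Phi x y)^-1 *: foot x y) = grad G (foot x y).
  by apply/rowP => i; rewrite !mxE (grad_homogeneous G G_smooth G_hom).
have hE : hessian G ((1 - t * Phi x y)^-1 *: foot x y) =
    (1 - t * Phi x y) *: hessian G (foot x y).
  by rewrite -((hess_homogeneous G G_smooth G_hom) _ _ tsi z0) scalerA divff ?scale1r ?lt0r_neq0.
have cE : (1 - dotp (grad G ((1 - t * Phi x y)^-1 *: foot x y)) (x + t *: y))^-1 =
    (1 - dotp (grad G (foot x y)) x)^-1 * (1 - t * Phi x y)^-1.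
  by rewrite gE dE invfM.
apply: (etrans (Phi_hess_form _ _ _ _ _ _ u v Wx' y0 zE cE gE hE)).
apply: (etrans _ (esym (Phi_hess_form _ _ _ _ _ _ u v Wx y0 erefl erefl erefl erefl))).
apply: hess_form_line; [exact: (hess_sym G G_smooth)|exact: (hess_euler G G_smooth G_hom)|exact: lt0r_neq0].
Qed.

Lemma near_W x0 y0 : W x0 -> y0 != 0 ->
  \forall p \near (x0, y0), W p.1 /\ p.2 != 0.
Proof.
move=> Wx0 y00; apply: filterI.
  apply: (@cvgr_lt _ _ (nbhs (x0, y0)) _ (fun p : 'rV[R]_n * 'rV[R]_n => A p.1) (A x0)) => //.
  by apply: (@cvg_comp _ _ _ fst A); [exact: cvg_fst|exact: A_cont].
have L : (snd p : 'rV[R]_n) @[p --> (x0, y0)] --> y0 by exact: cvg_snd.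
exact: (L nz (near_open _ _ open_nonzero y00)).
Qed.

Lemma cvg_comp_foot f x0 y0 : W x0 -> y0 != 0 -> smooth_on nz f ->
  f (foot p.1 p.2) @[p --> (x0, y0)] --> f (foot x0 y0).
Proof.
move=> Wx0 y00 sf.
apply: (@cvg_comp _ _ _ (fun p : 'rV[R]_n * 'rV[R]_n => foot p.1 p.2) f _ (nbhs (foot x0 y0))).
  exact: foot_cont.
exact: (sf [::] _ (foot_neq0 x0 y0 Wx0 y00)).1.
Qed.

Lemma cvg_grad_foot x0 y0 : W x0 -> y0 != 0 ->
  grad G (foot p.1 p.2) @[p --> (x0, y0)] --> grad G (foot x0 y0).
Proof.
move=> Wx0 y00; apply: (@cvg_row _ _ _ (nbhs (x0, y0))) => i.
under eq_cvg do rewrite mxE; rewrite mxE.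
exact: (cvg_comp_foot (partial i G) x0 y0 Wx0 y00 (smooth_partial _ _ _ G_smooth)).
Qed.

Lemma cvg_den_foot x0 y0 : W x0 -> y0 != 0 ->
  (1 - dotp (grad G (foot p.1 p.2)) p.1)^-1 @[p --> (x0, y0)] -->
  (1 - dotp (grad G (foot x0 y0)) x0)^-1.
Proof.
move=> Wx0 y00; apply: cvgV.
  by rewrite lt0r_neq0// subr_gt0 dG_lt1//; exact: foot_neq0.
apply: cvgB; first exact: cvg_cst.
apply: (@cvg_dotp _ _ _ (nbhs (x0, y0)) _ (fun p => grad G (foot p.1 p.2)) fst).
  exact: cvg_grad_foot.
exact: cvg_fst.
Qed.

Lemma cvg_Phi_grad x0 y0 : W x0 -> y0 != 0 ->
  grad (Phi p.1) p.2 @[p --> (x0, y0)] --> grad (Phi x0) y0.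
Proof.
move=> Wx0 y00; have L : (1 - dotp (grad G (foot p.1 p.2)) p.1)^-1 *: grad G (foot p.1 p.2) @[p --> (x0, y0)] -->
  (1 - dotp (grad G (foot x0 y0)) x0)^-1 *: grad G (foot x0 y0).
  by apply: cvgZ; [exact: cvg_den_foot|exact: cvg_grad_foot].
apply: (near_eq_cvg_to _ _ _ _ _ L (Phi_grad x0 y0 Wx0 y00)).
apply: filterS (near_W x0 y0 Wx0 y00) => p [Wp p0].
exact: (Phi_grad p.1 p.2 Wp p0).
Qed.

(** The explicit formula makes the Hessian jointly continuous without differentiating in [x].
    Continuity in [x] serves both the openness of the locus and limits taken from [U]. *)
Lemma cvg_Phi_hess x0 y0 u v : W x0 -> y0 != 0 ->
  qf (hessian (Phi p.1) p.2) u v @[p --> (x0, y0)] --> qf (hessian (Phi x0) y0) u v.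
Proof.
move=> Wx0 y00.
pose h (p : 'rV[R]_n * 'rV[R]_n) := (1 - dotp (grad G (foot p.1 p.2)) p.1)^-1 *
   qf (hessian G (foot p.1 p.2)) (u + dotp (grad (Phi p.1) p.2) u *: p.1)
                           (v + dotp (grad (Phi p.1) p.2) v *: p.1).
have cl (w : 'rV[R]_n) : w + dotp (grad (Phi p.1) p.2) w *: p.1 @[p --> (x0, y0)] -->
    w + dotp (grad (Phi x0) y0) w *: x0.
  apply: cvgD; first exact: cvg_cst.
  apply: cvgZ; last exact: cvg_fst.
  apply: (@cvg_dotp _ _ _ (nbhs (x0, y0)) _ (fun p => grad (Phi p.1) p.2) (fun=> w)).
    exact: cvg_Phi_grad.
  exact: cvg_cst.
have L : h p @[p --> (x0, y0)] --> h (x0, y0).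
  apply: cvgM; first exact: cvg_den_foot.
  apply: (@cvg_qf _ _ _ (nbhs (x0, y0))); [|exact: cl|exact: cl].
  move=> i j; under eq_cvg do rewrite hessE; rewrite hessE.
  exact: (cvg_comp_foot (partial j (partial i G)) x0 y0 Wx0 y00
    (smooth_partial _ _ _ (smooth_partial _ _ _ G_smooth))).
apply: (near_eq_cvg_to _ _ _ _ _ L (Phi_hess x0 y0 u v Wx0 y00)).
apply: filterS (near_W x0 y0 Wx0 y00) => p [Wp p0].
exact: (Phi_hess p.1 p.2 u v Wp p0).
Qed.

End Implicit.

(** * Minkowski norms and the Hessian *)

Section Homogeneous.
Context {R : realType} {n : nat}.
Implicit Types (x y z v : 'rV[R]_n).
Local Notation nz := [set y : 'rV[R]_n | y != 0].

(** The interval is open because [0 < t] is what makes the inequality in [grad_support] strict. *)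
Lemma MVT_segment01 (f : 'rV[R]_n -> R) y v :
  (forall t, 0 <= t <= 1 -> derivable f (y + t *: v) v) ->
  exists2 t, 0 < t < 1 & f (y + v) - f y = 'D_v f (y + t *: v).
Proof.
move=> df; pose F (s : R) := f (y + s *: v).
have isF (t : R) : t \in `[0, 1] -> is_derive t 1 F ('D_v f (y + t *: v)).
  by rewrite in_itv/= => /df; exact: is_derive_line.
have [t + E] := @MVT R F (fun s => 'D_v f (y + s *: v)) 0 1 ltr01
  (fun t ta => isF t (subset_itv_oo_cc ta))
  (derivable_within_continuous (fun t ta => @ex_derive _ _ _ _ _ _ _ (isF t ta))).
rewrite in_itv/= => t01; exists t => //.
by move: E; rewrite /F scale1r scale0r addr0 subr0 mulr1.
Qed.

Variable f : 'rV[R]_n -> R.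
Hypothesis f_smooth : smooth_on nz f.
Hypothesis f_hom : pos_homogeneous f.
Hypothesis f_pos : forall y, y != 0 -> 0 < f y.

Lemma hess_sqr y u v : y != 0 ->
  qf (hessian (fun z => f z ^+ 2) y) u v =
  2 * (dotp (grad f y) u * dotp (grad f y) v + f y * qf (hessian f y) u v).
Proof.
move=> y0.
have df z i : z != 0 -> derivable f z 'e_i by move=> z0; exact: (f_smooth [::] z z0).2.
have E i j : partial j (partial i (fun z => f z ^+ 2)) y =
    2 * (partial i f y * partial j f y + f y * partial j (partial i f) y).
  have -> : partial j (partial i (fun z => f z ^+ 2)) y = 'D_'e_j (2 *: (f * partial i f)) y.
    apply: near_eq_derive.
    apply: filterS (near_open _ _ open_nonzero y0) => z z0.
    rewrite /partial (_ : (fun z => f z ^+ 2) = f * f); last by apply/funext => t; rewrite expr2.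
    rewrite deriveM; [|exact: df|exact: df].
    rewrite -[RHS]/(2 * (f z * 'D_'e_i f z)) /GRing.scale/=.
    by rewrite -mulr2n mulr_natl.
  have dpi : derivable (partial i f) y 'e_j by exact: (f_smooth [:: i] y y0).2.
  have dfj := df y j y0.
  have [_ ->] := is_deriveZ 2 (is_deriveM (derivableP dfj) (derivableP dpi)).
  rewrite /GRing.scale/= [X in 2 * X]addrC; congr (2 * (_ + _)).
rewrite [LHS]qfE; under eq_bigr => i _.
  under eq_bigr => j _.
    rewrite hessE E.
    have -> : 2 * (partial i f y * partial j f y + f y * partial j (partial i f) y) * u 0 i * v 0 j
      = 2 * ((partial i f y * u 0 i) * (partial j f y * v 0 j)
             + f y * (hessian f y i j * u 0 i * v 0 j)).
      rewrite hessE; move: (partial i f y) (partial j f y) (partial j _ y) (f y) => a b c d; ring.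
    over.
  over.
under eq_bigr do rewrite -mulr_sumr; rewrite -mulr_sumr; congr (_ * _).
under eq_bigr do rewrite big_split/= -!mulr_sumr; rewrite big_split/= -mulr_sumr -qfE.
rewrite -mulr_suml; congr (_ * _ + _); apply: eq_bigr => i _; first by rewrite mxE.
by rewrite mxE.
Qed.

Lemma hess_sqr_sym y : y != 0 ->
  (hessian (fun z => f z ^+ 2) y)^T = hessian (fun z => f z ^+ 2) y.
Proof.
move=> y0; apply/matrixP => i j.
apply: (etrans (mxE _ _ _ _)).
apply: (etrans (esym (qf_delta _ _ _))); apply: (etrans _ (qf_delta _ _ _)).
apply: (etrans (hess_sqr _ _ _ y0)); apply: (etrans _ (esym (hess_sqr _ _ _ y0))).
rewrite [dotp _ _ * _]mulrC; congr (_ * (_ + _ * _)).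
by apply: qf_sym; exact: hess_sym.
Qed.

(* Both conditions see only the Hessian of [f] transversally to [y], because
   [Hess (f^2) = 2 (df df + f Hess f)] and [Hess f] annihilates [y]. *)
Lemma posdef_sqr y : y != 0 ->
  posdef (hessian (fun z => f z ^+ 2) y) <->
  (forall v, ~ (exists c : R, v = c *: y) -> 0 < qf (hessian f y) v v).
Proof.
move=> y0.
have fy := f_pos y y0.
have KT := hess_sym f f_smooth y y0.
have Ky := hess_euler f f_smooth f_hom y y0.
have py : dotp (grad f y) y = f y := grad_euler f f_smooth f_hom y y0.
split=> [[_ S] v vy|S].
  (* [w] is [v] moved along [y] into the kernel of [df]; there only the term [f * Hess f] survives,
     and [Hess f] does not see the move. *)
  pose a := dotp (grad f y) v / f y.
  pose w := v - a *: y.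
  have w0 : w != 0.
    by apply/eqP => /eqP; rewrite subr_eq0 => /eqP E; apply: vy; exists a.
  have pw : dotp (grad f y) w = 0.
    by rewrite linearB linearZ/= py /GRing.scale/= /a divfK ?subrr// lt0r_neq0.
  have Sw : 0 < qf (hessian (fun z => f z ^+ 2) y) w w := S w w0.
  rewrite (hess_sqr y w w y0) pw mulr0 add0r in Sw; move: Sw.
  rewrite pmulr_rgt0// pmulr_rgt0//.
  by rewrite /w -scaleNr qf_radial.
split; first exact: hess_sqr_sym.
move=> v v0.
suff : 0 < qf (hessian (fun z => f z ^+ 2) y) v v by [].
rewrite (hess_sqr y v v y0) pmulr_rgt0//.
have [[c vE]|vy] := pselect (exists c : R, v = c *: y).
  have c0 : c != 0 by apply: contra v0 => /eqP c0; rewrite vE c0 scale0r.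
  have -> : qf (hessian f y) v v = 0.
    rewrite vE -[c *: y]add0r qf_radial//.
    by rewrite /qf !mul0mx mxE.
  rewrite mulr0 addr0 vE linearZ/= py /GRing.scale/= -expr2 exprn_even_gt0//=.
  by rewrite mulf_neq0// lt0r_neq0.
by rewrite ltr_wpDl// -?expr2 ?sqr_ge0// mulr_gt0// S.
Qed.

Section Strict.
Hypothesis K_pos : forall y v, y != 0 -> ~ (exists c : R, v = c *: y) ->
  0 < qf (hessian f y) v v.

(* Second order mean value theorem on the segment from [w] to [v]; the segment
   avoids the origin unless [v] is parallel to [w]. *)
Lemma grad_support w v : w != 0 ->
  dotp (grad f w) v <= f v /\
  (dotp (grad f w) v = f v -> exists2 c : R, 0 <= c & v = c *: w).
Proof.
move=> w0; have fw := f_pos w w0.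
have py : dotp (grad f w) w = f w := grad_euler f f_smooth f_hom w w0.
have f_ge0 z : 0 <= f z.
  by have [->|/f_pos/ltW//] := eqVneq z 0; rewrite pos_homogeneous0.
have [[c vE]|vw] := pselect (exists c : R, v = c *: w).
  have pv : dotp (grad f w) v = c * f w by rewrite vE linearZ/= py.
  have [c0|c0] := leP 0 c; last first.
    have lt : dotp (grad f w) v < f v.
      by rewrite pv (lt_le_trans _ (f_ge0 v))// pmulr_llt0.
    by split; [exact: ltW|move=> E; move: lt; rewrite E ltxx].
  split; last by move=> _; exists c.
  rewrite pv vE; move: c0; rewrite le_eqVlt => /predU1P[<-|c0].
    by rewrite mul0r scale0r pos_homogeneous0.
  by rewrite f_hom.
pose d := v - w.
(* If [d] were parallel to a point of the line [w + R d], then [v] would be parallel to [w]; hence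
   [K_pos] applies to [d] all along the segment. *)
have dw z : (exists s c : R, z = w + s *: d /\ d = c *: z) -> False.
  move=> [s [c [-> dE]]]; apply: vw.
  have E : (1 - c * s) *: d = c *: w.
    by rewrite scalerBl scale1r {1}dE scalerDr scalerA addrK.
  have cs : 1 - c * s != 0.
    apply/eqP => cs; move: E; rewrite cs scale0r => /esym/eqP.
    rewrite scaler_eq0 (negPf w0) orbF => /eqP c0.
    by move: cs; rewrite c0 mul0r subr0 => /eqP; rewrite oner_eq0.
  exists (1 + (1 - c * s)^-1 * c).
  rewrite scalerDl scale1r -scalerA -E scalerA mulVf// scale1r /d.
  by rewrite addrC subrK.
have seg0 s : w + s *: d != 0.
  apply/eqP => E; apply: vw.
  have s0 : s != 0 by apply: contra w0 => /eqP s0; move: E; rewrite s0 scale0r addr0 => ->.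
  exists (1 - s^-1).
  have sd : s *: d = - w by apply/eqP; rewrite -addr_eq0 addrC E.
  have dE : d = - (s^-1 *: w) by rewrite -scalerN -sd scalerA mulVf// scale1r.
  by rewrite scalerBl scale1r -dE /d addrC subrK.
have [t /andP[t0 t1] E1] := MVT_segment01 f w d
  (fun t _ => diff_derivable (punctured_diff f f_smooth _ (seg0 t))).
rewrite punctured_derive// in E1.
have seg1 t' : w + t' *: (t *: d) != 0 by rewrite scalerA seg0.
have gd t' := grad_is_derive f f_smooth _ d (t *: d) (seg1 t').
have [t' _] := MVT_segment01 (fun z => dotp (grad f z) d) w (t *: d)
  (fun t' _ => @ex_derive _ _ _ _ _ _ _ (gd t')).
have [_ ->] := gd t'; rewrite qfZr => E2.
have lt : dotp (grad f w) d < dotp (grad f (w + t *: d)) d.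
  rewrite -subr_gt0 E2 pmulr_rgt0//; apply: K_pos => //.
  move=> [c dE]; apply: (dw (w + t' *: (t *: d))); exists (t' * t), c.
  by rewrite -scalerA.
have : dotp (grad f w) v < f v.
  have -> : v = w + d by rewrite /d addrC subrK.
  rewrite linearD/= py -ltrBrDl E1.
  exact: lt.
by move=> ltv; split; [exact: ltW|move=> E; move: ltv; rewrite E ltxx].
Qed.

(** For [w = u + v] nonzero, [f w = df(w) u + df(w) v], and [grad_support] bounds each term.
    Equality in the sum forces equality in both bounds, so [u] and [v] are non-negative multiples of
    [w]. *)
Lemma weak_Minkowski_of_pos : weak_Minkowski_norm f.
Proof.
have f0 : f 0 = 0 by rewrite pos_homogeneous0.
have f_ge0 z : 0 <= f z by have [->|/f_pos/ltW//] := eqVneq z 0; rewrite f0.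
have f_eq0 z : f z = 0 -> z = 0.
  by move=> fz; apply/eqP; apply: contraT => /f_pos; rewrite fz ltxx.
have fE w : w != 0 -> f w = dotp (grad f w) w by move=> w0; rewrite grad_euler.
split=> //; first split=> //.
- move=> u v; have [->|w0] := eqVneq (u + v) 0; first by rewrite f0 addr_ge0.
  rewrite [leLHS]fE// linearD/=.
  by apply: lerD; [exact: (grad_support _ u w0).1|exact: (grad_support _ v w0).1].
- move=> u v; have [w0|w0] := eqVneq (u + v) 0.
    rewrite w0 f0 => /esym/eqP; rewrite paddr_eq0// => /andP[/eqP/f_eq0-> /eqP/f_eq0->].
    by exists 1, 1; split=> //; rewrite addr_gt0.
  move=> E; have [lu eu] := grad_support _ u w0; have [lv ev] := grad_support _ v w0.
  rewrite [LHS]fE// linearD/= in E.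
  have Eu : dotp (grad f (u + v)) u = f u by lra.
  have Ev : dotp (grad f (u + v)) v = f v by lra.
  have [c c0 uE] := eu Eu; have [c' c'0 vE] := ev Ev.
  have [cc|cc] := eqVneq (c + c') 0.
    have : u + v = (c + c') *: (u + v) by rewrite scalerDl -uE -vE.
    by rewrite cc scale0r => w00; move: w0; rewrite w00 eqxx.
  exists c', c; split=> //; first by rewrite lt_neqAle addr_ge0// andbT eq_sym addrC.
  apply: (etrans (congr1 ( *:%R c') uE)); apply: (etrans _ (esym (congr1 ( *:%R c) vE))).
  by rewrite !scalerA mulrC.
Qed.

End Strict.

(** The criterion is pointwise in [(y, v)], so it can be transported for one direction [y] at a
    time. *)
Lemma Minkowski_posdef : Minkowski_norm f <->
  (forall y v, y != 0 -> ~ (exists c : R, v = c *: y) -> 0 < qf (hessian f y) v v).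
Proof.
split=> [[_ S] y v y0|K]; first by apply/(posdef_sqr y y0).1; exact: S.
split; first exact: weak_Minkowski_of_pos.
by move=> y y0; apply/(posdef_sqr y y0).2 => v; exact: K.
Qed.

End Homogeneous.

(** * Hessian of a multiple of a difference *)

Section Combination.
Context {R : realType} {n : nat}.
Local Notation nz := [set y : 'rV[R]_n | y != 0].
Implicit Types (f g : 'rV[R]_n -> R) (x y z u v : 'rV[R]_n).

Lemma partial_comb f g (k : R) y (i : 'I_n) :
  derivable f y 'e_i -> derivable g y 'e_i ->
  partial i (fun z => k * (f z - g z)) y = k * (partial i f y - partial i g y).
Proof. by move=> df dg; have [_] := is_deriveZ k (is_deriveB (derivableP df) (derivableP dg)). Qed.

Lemma hess_comb f g (k : R) y u v : smooth_on nz f -> smooth_on nz g -> y != 0 ->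
  qf (hessian (fun z => k * (f z - g z)) y) u v =
  k * (qf (hessian f y) u v - qf (hessian g y) u v).
Proof.
move=> sf sg y0.
have E i j : partial j (partial i (fun z => k * (f z - g z))) y =
    k * (partial j (partial i f) y - partial j (partial i g) y).
  rewrite -partial_comb; [|exact: (sf [:: i] y y0).2|exact: (sg [:: i] y y0).2].
  apply: near_eq_derive; apply: filterS (near_open _ _ open_nonzero y0) => z z0.
  by apply: partial_comb; [exact: (sf [::] z z0).2|exact: (sg [::] z z0).2].
have entry (M N : 'M[R]_n) i j : k * (M i j - N i j) = (k *: (M - N)) i j by rewrite !mxE.
have -> : hessian (fun z => k * (f z - g z)) y = k *: (hessian f y - hessian g y).
  apply/matrixP => i j; apply: (etrans (hessE _ _ i j)); apply: (etrans (E i j)).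
  apply: (etrans _ (entry _ _ i j)).
  exact: (congr2 (fun a b => k * (a - b)) (esym (hessE f y i j)) (esym (hessE g y i j))).
by rewrite qf_scale /qf mulmxBr mulmxBl [in LHS]mxE [X in _ + X]mxE.
Qed.

End Combination.

(** * The function F and its Minkowski locus *)

Section Zermelo.
Context {R : realType} {n : nat}.
Local Notation nz := [set y : 'rV[R]_n | y != 0].
Implicit Types (x y z u v : 'rV[R]_n).
Variables (psi phi : 'rV[R]_n -> R) (Phip Phim F : 'rV[R]_n -> 'rV[R]_n -> R).
Hypothesis psi_Mink : Minkowski_norm psi.
Hypothesis phi_hom : pos_homogeneous phi.
Hypothesis sum_weak : weak_Minkowski_norm (fun y => psi y + phi y).
Let Gp y := phi y + psi y.
Let Gm y := phi y - psi y.
Local Notation W x := (Gp x < 1).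
Hypothesis hPhip : forall x y, W x -> unique (fun s : R => s = Gp (y + s *: x)) (Phip x y).
Hypothesis hPhim : forall x y, W x -> unique (fun s : R => s = Gm (y + s *: x)) (Phim x y).
Hypothesis hF : forall x y, W x -> F x y = 2^-1 * (Phip x y - Phim x y).

Let GpE : Gp = (fun y => psi y + phi y).
Proof. by apply/funext => y; rewrite /Gp addrC. Qed.

Let psi_hom : pos_homogeneous psi. Proof. by case: psi_Mink => -[[]]. Qed.
Let psi_ge0 y : 0 <= psi y. Proof. by case: psi_Mink => -[[_ h _ _]]. Qed.
Let psi_pos y : y != 0 -> 0 < psi y.
Proof.
move=> y0; rewrite lt_neqAle psi_ge0 andbT eq_sym; apply: contra y0 => /eqP h.
by case: psi_Mink => -[[_ _ /(_ y h)->]].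
Qed.
Let psi_smooth : smooth_on nz psi. Proof. by case: psi_Mink => -[]. Qed.
Let Gp_hom : pos_homogeneous Gp. Proof. by rewrite GpE; case: sum_weak => -[]. Qed.
Let Gp_ge0 y : 0 <= Gp y. Proof. by rewrite GpE; case: sum_weak => -[_ h]. Qed.
Let Gp_sub y z : Gp (y + z) <= Gp y + Gp z.
Proof. by rewrite GpE; case: sum_weak => -[_ _ _ h _ _]; exact: h. Qed.
Let Gp_smooth : smooth_on nz Gp. Proof. by rewrite GpE; case: sum_weak. Qed.
Let Gp_cont : continuous Gp.
Proof. by apply: homogeneous_continuous => // y y0; exact: (Gp_smooth [::] y y0).1. Qed.
Let Gm_hom : pos_homogeneous Gm.
Proof. by move=> a y a0; rewrite /Gm phi_hom// psi_hom// mulrBr. Qed.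
Let Gm_smooth : smooth_on nz Gm.
Proof.
apply: (smooth_ext nz (fun y => Gp y + -2 * psi y)); first exact: open_nonzero.
  by move=> y _; rewrite /Gp /Gm; ring.
apply: smoothD; [exact: open_nonzero|exact: Gp_smooth|].
by apply: smoothZ; [exact: open_nonzero|exact: psi_smooth].
Qed.
Let Gp_le y : Gp y <= Gp y. Proof. exact: lexx. Qed.
Let Gm_le y : Gm y <= Gp y.
Proof. by rewrite /Gm /Gp lerD2l; have := psi_ge0 y; lra. Qed.

Lemma F_difference x : W x -> F x = (fun y => 2^-1 * (Phip x y - Phim x y)).
Proof. by move=> Wx; apply/funext => y; exact: hF. Qed.

Let Pp_smooth := Phi_smooth Gp Gp Phip Gp_hom Gp_ge0 Gp_sub Gp_cont Gp_smooth Gp_hom Gp_le hPhip.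
Let Pm_smooth := Phi_smooth Gp Gm Phim Gp_hom Gp_ge0 Gp_sub Gp_cont Gm_smooth Gm_hom Gm_le hPhim.

Lemma F_smooth x : W x -> smooth_on nz (F x).
Proof.
move=> Wx; rewrite (F_difference x Wx).
apply: (smoothZ nz 2^-1 (fun y => Phip x y - Phim x y)); first exact: open_nonzero.
apply: (smooth_ext nz (fun y => Phip x y + -1 * Phim x y)); first exact: open_nonzero.
  by move=> y _; rewrite mulN1r.
apply: smoothD; [exact: open_nonzero|exact: Pp_smooth|].
by apply: smoothZ; [exact: open_nonzero|exact: Pm_smooth].
Qed.

Lemma F_hom x : W x -> pos_homogeneous (F x).
Proof.
move=> Wx a y a0; rewrite !hF//.
have -> : Phip x (a *: y) = a * Phip x y.
  apply: (Phi_eq Gp Gp Phip hPhip) => //.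
  by rewrite -scalerA -scalerDr Gp_hom//; congr (_ * _); exact: (PhiE Gp Gp Phip hPhip).
have -> : Phim x (a *: y) = a * Phim x y.
  apply: (Phi_eq Gp Gm Phim hPhim) => //.
  by rewrite -scalerA -scalerDr Gm_hom//; congr (_ * _); exact: (PhiE Gp Gm Phim hPhim).
by rewrite -mulrBr mulrCA.
Qed.

(** The increasing function [s - Gm (y + s *: x)] equals [2 psi(z) > 0] at [Phip x y] and vanishes
    at [Phim x y], so [Phim x y < Phip x y]. *)
Lemma F_pos x y : W x -> y != 0 -> 0 < F x y.
Proof.
move=> Wx y0; rewrite hF// pmulr_rgt0// subr_gt0.
have z0 := foot_neq0 Gp Gp Phip Gp_hom hPhip x y Wx y0.
rewrite ltNge; apply/negP => le.
have hm : Phim x y - Gm (y + Phim x y *: x) = 0.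
  by rewrite -(PhiE Gp Gm Phim hPhim)// subrr.
have hp : 0 < Phip x y - Gm (y + Phip x y *: x).
  rewrite {1}(PhiE Gp Gp Phip hPhip x y Wx).
  have -> z : Gp z - Gm z = 2 * psi z by rewrite /Gp /Gm; ring.
  by rewrite pmulr_rgt0// psi_pos.
move: le; rewrite le_eqVlt => /predU1P[E|lt]; first by move: hp; rewrite E hm ltxx.
have := shift_increasing Gp Gm Phim Gp_hom Gp_ge0 Gp_sub Gm_smooth Gm_hom Gm_le hPhim x y _ _ Wx lt.
by rewrite hm => /(lt_trans hp); rewrite ltxx.
Qed.

Lemma F_grad x y : W x -> y != 0 ->
  grad (F x) y = 2^-1 *: (grad (Phip x) y - grad (Phim x) y).
Proof.
move=> Wx y0; rewrite F_difference//; apply/rowP => i; rewrite !mxE.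
by apply: partial_comb; [exact: (Pp_smooth x Wx [::] y y0).2|exact: (Pm_smooth x Wx [::] y y0).2].
Qed.

Lemma F_hess x y u v : W x -> y != 0 ->
  qf (hessian (F x) y) u v =
  2^-1 * (qf (hessian (Phip x) y) u v - qf (hessian (Phim x) y) u v).
Proof.
move=> Wx y0; rewrite F_difference//.
exact: (hess_comb _ _ _ _ _ _ (Pp_smooth x Wx) (Pm_smooth x Wx) y0).
Qed.

Lemma F_line x y t u v : W x -> W (x + t *: y) -> y != 0 ->
  qf (hessian (F (x + t *: y)) y) u v = qf (hessian (F x) y) u v.
Proof.
move=> Wx Wx' y0.
apply: (etrans (F_hess _ _ _ _ Wx' y0)); apply: (etrans _ (esym (F_hess _ _ _ _ Wx y0))).
exact: (congr2 (fun a b => 2^-1 * (a - b))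
  (hess_line_invariance Gp Gp Phip Gp_hom Gp_ge0 Gp_sub Gp_cont Gp_smooth Gp_hom Gp_le hPhip
     x y t u v Wx Wx' y0)
  (hess_line_invariance Gp Gm Phim Gp_hom Gp_ge0 Gp_sub Gp_cont Gm_smooth Gm_hom Gm_le hPhim
     x y t u v Wx Wx' y0)).
Qed.

Lemma cvg_F x0 y0 : W x0 -> y0 != 0 -> F p.1 p.2 @[p --> (x0, y0)] --> F x0 y0.
Proof.
move=> Wx0 y00.
have L : 2^-1 * (Phip p.1 p.2 - Phim p.1 p.2) @[p --> (x0, y0)] --> 2^-1 * (Phip x0 y0 - Phim x0 y0).
  apply: cvgM; first exact: cvg_cst.
  apply: cvgB.
    exact: (Phi_cont Gp Gp Phip Gp_hom Gp_ge0 Gp_sub Gp_cont Gp_smooth Gp_hom Gp_le hPhip).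
  exact: (Phi_cont Gp Gm Phim Gp_hom Gp_ge0 Gp_sub Gp_cont Gm_smooth Gm_hom Gm_le hPhim).
apply: (near_eq_cvg_to _ _ _ _ _ L (hF x0 y0 Wx0)).
by apply: filterS (near_W Gp Gp_cont x0 y0 Wx0 y00) => p [Wp p0]; exact: hF.
Qed.

Lemma cvg_F_grad x0 y0 : W x0 -> y0 != 0 ->
  grad (F p.1) p.2 @[p --> (x0, y0)] --> grad (F x0) y0.
Proof.
move=> Wx0 y00.
have L : 2^-1 *: (grad (Phip p.1) p.2 - grad (Phim p.1) p.2) @[p --> (x0, y0)] -->
    2^-1 *: (grad (Phip x0) y0 - grad (Phim x0) y0).
  apply: cvgZ; first exact: cvg_cst.
  apply: cvgB.
    exact: (cvg_Phi_grad Gp Gp Phip Gp_hom Gp_ge0 Gp_sub Gp_cont Gp_smooth Gp_hom Gp_le hPhip).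
  exact: (cvg_Phi_grad Gp Gm Phim Gp_hom Gp_ge0 Gp_sub Gp_cont Gm_smooth Gm_hom Gm_le hPhim).
apply: (near_eq_cvg_to _ _ _ _ _ L (F_grad x0 y0 Wx0 y00)).
by apply: filterS (near_W Gp Gp_cont x0 y0 Wx0 y00) => p [Wp p0]; exact: F_grad.
Qed.

Lemma cvg_F_hess x0 y0 u v : W x0 -> y0 != 0 ->
  qf (hessian (F p.1) p.2) u v @[p --> (x0, y0)] --> qf (hessian (F x0) y0) u v.
Proof.
move=> Wx0 y00.
have L : 2^-1 * (qf (hessian (Phip p.1) p.2) u v - qf (hessian (Phim p.1) p.2) u v)
   @[p --> (x0, y0)] -->
    2^-1 * (qf (hessian (Phip x0) y0) u v - qf (hessian (Phim x0) y0) u v).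
  apply: cvgM; first exact: cvg_cst.
  apply: cvgB.
    exact: (cvg_Phi_hess Gp Gp Phip Gp_hom Gp_ge0 Gp_sub Gp_cont Gp_smooth Gp_hom Gp_le hPhip).
  exact: (cvg_Phi_hess Gp Gm Phim Gp_hom Gp_ge0 Gp_sub Gp_cont Gm_smooth Gm_hom Gm_le hPhim).
apply: (near_eq_cvg_to _ _ _ _ _ L (F_hess x0 y0 u v Wx0 y00)).
by apply: filterS (near_W Gp Gp_cont x0 y0 Wx0 y00) => p [Wp p0]; exact: F_hess.
Qed.

Definition sqr_form x y v := qf (hessian (fun z => F x z ^+ 2) y) v v.

Lemma sqr_formE x y v : W x -> y != 0 -> sqr_form x y v =
  2 * (dotp (grad (F x) y) v * dotp (grad (F x) y) v + F x y * qf (hessian (F x) y) v v).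
Proof. by move=> Wx y0; exact: (hess_sqr (F x) (F_smooth x Wx)). Qed.

(** The parameter [x] comes last, as the near-covering form of compactness expects in
    [open_locus]. *)
Lemma cvg_sqr_form x0 y0 v0 : W x0 -> y0 != 0 ->
  sqr_form q.2 q.1.1 q.1.2 @[q --> ((y0, v0), x0)] --> sqr_form x0 y0 v0.
Proof.
move=> Wx0 y00.
pose T := ((('rV[R]_n * 'rV[R]_n) * 'rV[R]_n)%type).
have cy : (fun q : T => (q.2, q.1.1)) @ ((y0, v0), x0) --> (x0, y0).
  apply: (@cvg_pair _ _ _ (nbhs ((y0, v0), x0)) (nbhs x0) (nbhs y0) _ _ _
    (fun q : T => q.2) (fun q => q.1.1)); first exact: cvg_snd.
  by apply: (@cvg_comp _ _ _ (fun q : T => q.1) fst _ (nbhs (y0, v0))); exact: cvg_fst.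
have cv : (fun q : T => q.1.2) @ ((y0, v0), x0) --> v0.
  by apply: (@cvg_comp _ _ _ (fun q : T => q.1) snd _ (nbhs (y0, v0))); [exact: cvg_fst|exact: cvg_snd].
have nW : \forall q \near ((y0, v0), x0), W q.2 /\ q.1.1 != 0.
  exact: (cy _ (near_W Gp Gp_cont x0 y0 Wx0 y00)).
have cg : dotp (grad (F q.2) q.1.1) q.1.2 @[q --> ((y0, v0), x0)] --> dotp (grad (F x0) y0) v0.
  apply: (@cvg_dotp _ _ _ (nbhs ((y0, v0), x0)) _ (fun q : T => grad (F q.2) q.1.1) (fun q => q.1.2)) => //.
  exact: (@cvg_comp _ _ _ _ _ _ _ _ cy (cvg_F_grad x0 y0 Wx0 y00)).
have cF : F q.2 q.1.1 @[q --> ((y0, v0), x0)] --> F x0 y0.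
  exact: (@cvg_comp _ _ _ _ _ _ _ _ cy (cvg_F x0 y0 Wx0 y00)).
have cK : qf (hessian (F q.2) q.1.1) q.1.2 q.1.2 @[q --> ((y0, v0), x0)] --> qf (hessian (F x0) y0) v0 v0.
  apply: (@cvg_qf _ _ _ (nbhs ((y0, v0), x0))) => // i j.
  under eq_cvg do rewrite -qf_delta; rewrite -qf_delta.
  exact: (@cvg_comp _ _ _ _ _ _ _ _ cy (cvg_F_hess x0 y0 'e_i 'e_j Wx0 y00)).
have L : 2 * (dotp (grad (F q.2) q.1.1) q.1.2 * dotp (grad (F q.2) q.1.1) q.1.2 +
   F q.2 q.1.1 * qf (hessian (F q.2) q.1.1) q.1.2 q.1.2) @[q --> ((y0, v0), x0)] -->
   2 * (dotp (grad (F x0) y0) v0 * dotp (grad (F x0) y0) v0 + F x0 y0 * qf (hessian (F x0) y0) v0 v0).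
  apply: cvgM; first exact: cvg_cst.
  by apply: cvgD; apply: cvgM.
apply: (near_eq_cvg_to _ _ _ _ _ L (sqr_formE x0 y0 v0 Wx0 y00)).
by apply: filterS nW => q [Wq q0]; exact: sqr_formE.
Qed.

Lemma sqr_form_scale x y v (a b : R) : W x -> y != 0 -> 0 < a ->
  sqr_form x (a *: y) (b *: v) = b ^+ 2 * sqr_form x y v.
Proof.
move=> Wx y0 a0; have ay0 : a *: y != 0 by rewrite scaler_eq0 negb_or y0 lt0r_neq0.
rewrite !sqr_formE//.
have -> : grad (F x) (a *: y) = grad (F x) y.
  apply/rowP => i; rewrite !mxE.
  by rewrite (grad_homogeneous (F x) (F_smooth x Wx) (F_hom x Wx)).
rewrite (F_hom x Wx)// -(hess_homogeneous (F x) (F_smooth x Wx) (F_hom x Wx) y a)//.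
rewrite linearZ/= qf_scale qfZl qfZr /GRing.scale/=.
move: (qf _ v v) (dotp _ v) (F x y) => k d f; ring.
Qed.

Local Notation O := (Minkowski_locus [set x | W x] F).

(** The form of the square is positive on all nonzero [v], so it can be tested on the compact set of
    pairs of unit vectors; pairs of non-parallel unit vectors do not form a compact set in
    general. *)
Lemma locus_posdef x : W x ->
  Minkowski_norm (F x) <-> forall y v, y != 0 -> v != 0 -> 0 < sqr_form x y v.
Proof.
move=> Wx; split=> [[_ S] y v y0 v0|S]; first exact: (S y y0).2.
apply/(Minkowski_posdef (F x) (F_smooth x Wx) (F_hom x Wx) (fun y => F_pos x y Wx)).
move=> y v y0; apply: (posdef_sqr (F x) (F_smooth x Wx) (F_hom x Wx) (fun y => F_pos x y Wx) y y0).1.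
split; first exact: (hess_sqr_sym (F x) (F_smooth x Wx)).
by move=> w w0; exact: S.
Qed.

Lemma open_W : open [set x | W x].
Proof.
apply: (@open_comp _ _ Gp [set r : R | r < 1]); last exact: open_lt.
by move=> x _; exact: Gp_cont.
Qed.

Lemma open_locus : open O.
Proof.
rewrite openE => x0 [Wx0 Mx0].
have S0 := (locus_posdef x0 Wx0).1 Mx0.
pose sph := [set v : 'rV[R]_n | `|v| = 1].
have sph0 v : sph v -> v != 0 by rewrite /sph/= -normr_eq0 => ->; exact: oner_neq0.
have cc : compact (sph `*` sph) by apply: compact_setX; exact: sphere_compact.
have nS : \forall x \near x0, (sph `*` sph) `<=` (fun q => 0 < sqr_form x q.1 q.2).
  have cc' := (compact_near_coveringP _).1 cc.
  apply: (cc' _ (nbhs x0) (fun x q => 0 < sqr_form x q.1 q.2)).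
  move=> [y v] [/= /sph0 y0 /sph0 v0].
  exact: (cvgr_gt (sqr_form x0 y v) (cvg_sqr_form x0 y v Wx0 y0) _ (S0 y v y0 v0)).
have nW : \forall x \near x0, W x by exact: (near_open _ _ open_W Wx0).
rewrite /interior/=.
apply: filterS2 nS nW => x Sx Wx; split; first exact: Wx.
apply/(locus_posdef x Wx) => y v y0 v0.
have ny : 0 < `|y| by rewrite normr_gt0.
have nv : 0 < `|v| by rewrite normr_gt0.
have unit w : w != 0 -> sph (`|w|^-1 *: w).
  move=> w0; rewrite /sph/= normrZ normfV normr_id mulVf//.
  by rewrite normr_eq0.
have := Sx (`|y|^-1 *: y, `|v|^-1 *: v) (conj (unit y y0) (unit v v0)).
rewrite /= sqr_form_scale ?invr_gt0// pmulr_rgt0// exprn_gt0// invr_gt0.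
by rewrite normr_gt0.
Qed.

End Zermelo.

(** * Convex sets and connected components *)

Section Separation.
Context {R : realType} {n : nat}.
Implicit Types (x y z u v p b : 'rV[R]_n) (S : set 'rV[R]_n).

Definition convex_in S := forall u v (t : R), S u -> S v -> 0 <= t <= 1 ->
  S (t *: u + (1 - t) *: v).

Lemma affine_continuous (a : 'rV[R]_n) (k : R) : continuous (fun v : 'rV[R]_n => a + k *: v).
Proof.
move=> v; have did := @ex_diff _ _ _ _ _ _ _ (is_diff_id v).
exact: (@differentiable_continuous _ _ _ v (cst a + k *: id)
  (differentiableD (differentiable_cst a v) (differentiableZ k did))).
Qed.

Lemma translation_continuous (a : 'rV[R]_n) : continuous (fun v : 'rV[R]_n => v + a).
Proof.
have -> : (fun v : 'rV[R]_n => v + a) = (fun v => a + 1 *: v); last exact: affine_continuous.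
by apply/funext => v; rewrite scale1r addrC.
Qed.

Lemma dotpC u v : dotp u v = dotp v u.
Proof. by apply: eq_bigr => i _; rewrite mulrC. Qed.

Lemma dotpDl u v w : dotp (u + v) w = dotp u w + dotp v w.
Proof. by rewrite dotpC linearD/= dotpC [dotp w v]dotpC. Qed.

Lemma dotp_sqrD u v (t : R) :
  dotp (u + t *: v) (u + t *: v) = dotp u u + t * (2 * dotp u v + t * dotp v v).
Proof.
have Dr a b c : dotp a (b + c) = dotp a b + dotp a c by rewrite linearD.
have Zr a b (k : R) : dotp a (k *: b) = k * dotp a b by rewrite linearZ.
by rewrite dotpDl dotpZl !Dr !Zr [dotp v u]dotpC; ring.
Qed.

Lemma dotp_ge0 v : 0 <= dotp v v.
Proof. by apply: sumr_ge0 => i _; rewrite -expr2 sqr_ge0. Qed.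

Lemma dotp_coord v i : v 0 i ^+ 2 <= dotp v v.
Proof.
rewrite /dotp (bigD1 i)//= expr2 lerDl; apply: sumr_ge0 => j _.
by rewrite -expr2 sqr_ge0.
Qed.

(** [b] is [p - c] for the Euclidean nearest point [c] of the closure, scaled to sup norm one so
    that a limit of such normals can be extracted from a compact sphere. *)
Lemma nearest_point S p : convex_in S -> S !=set0 -> ~ closure S p ->
  exists2 b, `|b| = 1 & forall s, S s -> dotp b s <= dotp b p.
Proof.
move=> cS [s0 Ss0] Np.
pose f v := dotp (v - p) (v - p).
have fc : continuous f.
  move=> v; have cvp := translation_continuous (- p) v.
  exact: (@cvg_dotp _ _ _ (nbhs v) _ (fun u => u - p) (fun u => u - p) _ _ cvp cvp).
(* Only points no farther from [p] than [s0] matter, and they form a compact set. *)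
pose K := closure S `&` [set v | f v <= f s0].
have Kcl : closed K.
  apply: closedI; first exact: closed_closure.
  apply: (@closed_comp _ _ f [set r : R | r <= f s0]); last exact: closed_le.
  by move=> v _; exact: fc.
have Kbd : bounded_set K.
  exists (`|p| + (1 + f s0)); split; [exact: num_real|move=> M ltM v [_ /= fv]].
  apply: le_trans (ltW ltM).
  rewrite -[v](subrK p) addrC (le_trans (ler_normD _ _))// lerD2l.
  have fs0 : 0 <= f s0 by exact: dotp_ge0.
  apply: norm_le_coord => [|i]; first by rewrite addr_ge0.
  have := le_trans (dotp_coord (v - p) i) fv.
  rewrite -real_normK ?num_real//; move: `|(v - p) 0 i| (normr_ge0 ((v - p) 0 i)) (f s0) fs0 => a a0 F F0 aF.
  by nra.
have K0 : K !=set0 by exists s0; split; [exact: (@subset_closure _ S s0 Ss0)|exact: lexx].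
have [c /set_mem[Cc fcs0] cmin] := EVT_min_rV K0 (bounded_closed_compact Kbd Kcl)
  (continuous_subspaceT fc).
have fmin v : closure S v -> f c <= f v.
  move=> Cv; have [le|/ltW gt] := leP (f v) (f s0); last exact: (le_trans fcs0).
  by apply: cmin; apply/mem_set.
have seg s (t : R) : S s -> 0 <= t <= 1 -> closure S (t *: s + (1 - t) *: c).
  move=> Ss t01 B nB.
  have cg := affine_continuous (t *: s) (1 - t) c.
  have [v [Sv Bv]] := Cc _ (cg _ nB).
  by exists (t *: s + (1 - t) *: v); split=> //; exact: cS.
have var s : S s -> 0 <= dotp (c - p) (s - c).
  move=> Ss; set d := s - c; set X := dotp _ _; rewrite leNgt; apply/negP => X0.
  have D0 := dotp_ge0 d; set D := dotp d d in D0.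
  have DX : 0 < D - X by lra.
  (* This step satisfies [t * D <= - X], so the squared distance would change by
     [t * (2 * X + t * D) <= t * X < 0]. *)
  pose t := - X / (D - X).
  have t0 : 0 < t by rewrite divr_gt0// oppr_gt0.
  have t1 : t <= 1 by rewrite ler_pdivrMr// mul1r; lra.
  have := fmin _ (seg s t Ss _); rewrite (ltW t0) t1 => /(_ isT).
  have -> : t *: s + (1 - t) *: c = c + t *: d.
    by rewrite /d scalerBl scale1r scalerBr addrCA.
  have -> : f (c + t *: d) = f c + t * (2 * X + t * D).
    by rewrite /f addrAC dotp_sqrD.
  rewrite lerDl pmulr_rge0//.
  have : t * D <= - X by rewrite /t mulrAC ler_pdivrMr//; nra.
  by lra.
pose b := p - c.
have b0 : 0 < `|b|.
  by rewrite normr_gt0 subr_eq0; apply/eqP => pc; apply: Np; rewrite pc.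
exists (`|b|^-1 *: b).
  by rewrite normrZ normfV normr_id mulVf// lt0r_neq0.
move=> s Ss; rewrite !dotpZl ler_pM2l ?invr_gt0//.
have h1 : 0 <= dotp b b := dotp_ge0 b.
have h2 := var s Ss.
have E1 : dotp b s = dotp b (s - c) + dotp b c by rewrite !linearB/= subrK.
have E2 : dotp b p = dotp b b + dotp b c by rewrite {3}/b linearB/= subrK.
have E3 : dotp b (s - c) = - dotp (c - p) (s - c).
  have -> : b = -1 *: (c - p) by rewrite scaleN1r opprB.
  by rewrite dotpZl mulN1r.
by rewrite E1 E2 lerD2r E3; lra.
Qed.

(* Separate the points [- s0 / k], which are outside the closure of [S], and pass
   to a cluster point of the unit normals. *)
Lemma separation0 S : convex_in S -> open S -> S !=set0 -> ~ S 0 ->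
  exists2 b, b != 0 & forall s, S s -> dotp b s <= 0.
Proof.
move=> cS oS [s0 Ss0] S0.
(* Otherwise some [c] in [S] near [- e *: s0] has [- c / e] near [s0], hence in [S], and [0] is a
   convex combination of these two points. *)
have Ncl (e : R) : 0 < e -> ~ closure S (- e *: s0).
  move=> e0 cl; have /nbhs_ballP[r /= r0 hr] : nbhs s0 S by exact: near_open.
  have [c [Sc]] := cl _ (@nbhsx_ballx _ 'rV[R]_n (- e *: s0) (e * r) (mulr_gt0 e0 r0)).
  rewrite -ball_normE /ball_/= => cb.
  have Ss' : S (- e^-1 *: c).
    apply: hr; rewrite -ball_normE /ball_/=.
    have -> : s0 - - e^-1 *: c = e^-1 *: - (- e *: s0 - c).
      by rewrite opprB scalerBr scalerA mulrN mulVf ?lt0r_neq0// scaleN1r opprK scaleNr opprK addrC.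
    by rewrite normrZ gtr0_norm ?invr_gt0// normrN mulrC ltr_pdivrMr// mulrC.
  apply: S0; have e1 : 1 + e != 0 by rewrite lt0r_neq0// addr_gt0.
  have t01 : 0 <= e / (1 + e) <= 1.
    have e1p : 0 < 1 + e by rewrite addr_gt0.
    apply/andP; split; first by apply: divr_ge0; exact: ltW.
    by rewrite ler_pdivrMr// mul1r lerDr.
  have := cS _ _ _ Ss' Sc t01.
  rewrite scalerA -scalerDl.
  have -> : e / (1 + e) * - e^-1 + (1 - e / (1 + e)) = 0.
    by field; rewrite e1 lt0r_neq0.
  by rewrite scale0r.
pose M := \sum_i `|s0 0 i|.
(* Since [|b| = 1], the value of [b] at the separated point is at most [M / (k + 1)], which tends to
   [0]. *)
have ex k : exists b, `|b| = 1 /\ forall s, S s -> dotp b s <= k.+1%:R^-1 * M.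
  have k0 : 0 < k.+1%:R^-1 :> R by rewrite invr_gt0.
  have [b b1 bS] := nearest_point S _ cS (ex_intro _ s0 Ss0) (Ncl _ k0).
  exists b; split=> // s /bS/le_trans; apply.
  have -> : dotp b (- k.+1%:R^-1 *: s0) = k.+1%:R^-1 * - dotp b s0.
    by rewrite dotpC dotpZl mulNr mulrN dotpC.
  rewrite ler_pM2l//.
  rewrite (le_trans (ler_norm _))// normrN dotpC (le_trans (dotp_le_norm _ _))//.
  by rewrite b1 mulr1.
have [b hb] := choice ex.
have [b0 [b01 clb]] : [set v : 'rV[R]_n | `|v| = 1] `&` cluster (b @ \oo) !=set0.
  apply: sphere_compact; apply: (@filterE _ \oo) => k.
  exact: (hb k).1.
exists b0; first by rewrite -normr_eq0 b01 oner_neq0.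
move=> s Ss; rewrite leNgt; apply/negP => s_gt.
pose d := dotp b0 s / 2.
have d0 : 0 < d by rewrite divr_gt0.
have nb : nbhs b0 [set v | d < dotp v s].
  have : (fun v => dotp v s) @ b0 --> dotp b0 s.
    by apply: (@cvg_dotp _ _ _ (nbhs b0) _ id (fun=> s)); [exact: cvg_id|exact: cvg_cst].
  by move=> /(@cvgr_gt _ _ (nbhs b0)); apply; rewrite /d; lra.
have nk : (b @ \oo) [set v | dotp v s <= d].
  have : (fun k => k.+1%:R^-1 * M) @ \oo --> (0 * M : R).
    by apply: cvgM; [exact: cvg_harmonic|exact: cvg_cst].
  rewrite mul0r => /(@cvgr_lt _ _ \oo)/(_ _ d0); apply: filterS => k /= kM.
  exact: le_trans ((hb k).2 s Ss) (ltW kM).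
have [v [/= v1 v2]] := clb _ _ nk nb.
by move: v1; rewrite leNgt v2.
Qed.

(** The set [U - x + R y] is convex, open and misses [0], so it can be separated from [0]; a linear
    form bounded above on it must vanish on [y]. *)
Lemma line_separation U x y : convex_in U -> open U -> U !=set0 ->
  (forall t : R, ~ U (x + t *: y)) ->
  exists b, [/\ b != 0, dotp b y = 0 & forall u, U u -> dotp b (u - x) <= 0].
Proof.
move=> cU oU [u0 Uu0] NU.
pose S : set 'rV[R]_n := [set s | exists2 t : R, True & U (s + x - t *: y)].
have [||||b b0 bS] := separation0 S.
- move=> u v t [tu _ Uu] [tv _ Uv] t01; exists (t * tu + (1 - t) * tv) => //.
  have := cU _ _ t Uu Uv t01; congr U.
  apply/rowP => i; rewrite !mxE.
  by move: (u 0 i) (v 0 i) (x 0 i) (y 0 i) => a b c d; ring.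
- rewrite openE => s [t _ Us]; rewrite /interior.
  rewrite -addrA in Us; have cc := translation_continuous (x - t *: y) s.
  have ns : nbhs s [set s' | U (s' + (x - t *: y))] := cc _ (near_open _ _ oU Us).
  apply: filterS ns => s' Us'.
  by exists t => //; rewrite -addrA.
- by exists (u0 - x); exists 0 => //; rewrite scale0r subr0 subrK.
- by move=> [t _]; rewrite add0r -scaleNr; exact: NU.
exists b; split=> //.
  have h t : dotp b (u0 - x) + t * dotp b y <= 0.
    have -> : dotp b (u0 - x) + t * dotp b y = dotp b (u0 - x + t *: y).
      by rewrite [RHS]linearD/= [dotp b (t *: y)]linearZ.
    by apply: bS; exists t => //; rewrite addrAC addrK subrK.
  apply/eqP; apply: contraT => by0.
  (* For this [t] the quantity that should be non-positive equals [1]. *)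
  have := h ((1 - dotp b (u0 - x)) / dotp b y); rewrite divfK//; lra.
by move=> u Uu; apply: bS; exists 0 => //; rewrite scale0r subr0 subrK.
Qed.

End Separation.

(** * Components of open sets, non-tangent lines, kernels of semidefinite forms *)

Section Components.
Context {R : realType} {n : nat}.
Implicit Types (x y z u v : 'rV[R]_n) (O U : set 'rV[R]_n).

Lemma convex_in_of_set U : convex_set (U : set (convex_lmodType 'rV[R]_n)) -> convex_in U.
Proof.
move=> cU u v t Uu Uv /andP[t0 t1].
by have /set_mem := cU u v (Itv01 t0 t1) (mem_set Uu) (mem_set Uv).
Qed.

Lemma ball_component O x : open O -> O x ->
  exists2 r : R, 0 < r & ball x r `<=` connected_component O x.
Proof.
move=> oO Ox; have /nbhs_ballP[r /= r0 hr] : nbhs x O by exact: near_open.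
exists r => // z zb.
pose seg := (fun t : R => x + t *: (z - x)) @` `[0, 1].
have : seg `<=` connected_component O x; last first.
  apply; exists 1; first by rewrite /= in_itv/= ler01 lexx.
  by rewrite scale1r addrC subrK.
apply: connected_component_max.
- by exists 0; rewrite /= ?in_itv/= ?lexx ?ler01// scale0r addr0.
- move=> _ [t /= + <-]; rewrite in_itv/= => /andP[t0 t1]; apply: hr.
  move: zb; rewrite -!ball_normE /ball_/= => zb.
  rewrite opprD addrA subrr sub0r normrN normrZ ger0_norm// distrC.
  by apply: le_lt_trans zb; rewrite -[leRHS]mul1r ler_wpM2r.
- apply: connected_continuous_connected; first exact: segment_connected.
  apply: continuous_subspaceT => t; exact: line_continuous.
Qed.

Lemma open_component O x0 : open O -> open (connected_component O x0).
Proof.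
move=> oO; rewrite openE => x Ux.
have Ox : O x := connected_component_sub Ux.
have [r r0 hr] := ball_component O x oO Ox.
apply/nbhs_ballP; exists r => //= z /hr.
by rewrite (same_connected_component Ux).
Qed.

(** A ball about [x] lies in the component of [x] and meets that of [x0], so the two coincide. Hence
    a boundary point of a component of an open set lies outside that set. *)
Lemma closure_component O x0 x : open O -> O x ->
  closure (connected_component O x0) x -> connected_component O x0 x.
Proof.
move=> oO Ox cl; have [r r0 hr] := ball_component O x oO Ox.
have [u [Uu /hr xu]] := cl _ (nbhsx_ballx x r r0).
by rewrite (same_connected_component Uu); exact: connected_component_sym.
Qed.

(** A line through [x] missing [U] lies in a supporting hyperplane, which at a smooth point can only
    be the tangent one. *)
Lemma nontangent_hits U x y : convex_in U -> open U -> U !=set0 ->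
  smooth_boundary_point U x -> ~ tangent_at U x y -> exists t : R, U (x + t *: y).
Proof.
move=> cU oU U0 [_ [H HT]] ny; apply: contrapT => NU.
have [b [b0 by0 bU]] := line_separation U x y cU oU U0 (fun t Ut => NU (ex_intro _ t Ut)).
apply: ny; exists H => //.
have <- : [set v | dotp b v = 0] = H.
  by apply: HT.2; exists b.
by [].
Qed.

(** [v] minimises the form, so the first variation at [v] vanishes in every direction. *)
Lemma psd_kernel (K : 'M[R]_n) v : K^T = K -> (forall w, 0 <= qf K w w) ->
  qf K v v = 0 -> v *m K = 0.
Proof.
move=> KT psd vv.
have q0 w : qf K v w = 0.
  have key (s : R) : 0 <= s * (2 * qf K v w + s * qf K w w).
    have := psd (v + s *: w); rewrite !qfDl !qfDr !qfZl !qfZr vv (qf_sym K w v KT).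
    by rewrite (_ : 0 + _ + _ = s * (2 * qf K v w + s * qf K w w)); last by ring.
  have ww := psd w; move: (qf K v w) (qf K w w) ww key => X D D0 key.
  apply/eqP; apply: contraT => X0.
  have D1 : 0 < D + 1 by rewrite ltr_wpDl.
  (* [D + 1] avoids division by a vanishing [D], and the value at this [s] is still negative for
     nonzero [X]. *)
  have := key (- X / (D + 1)).
  have -> : - X / (D + 1) * (2 * X + - X / (D + 1) * D) =
    - (X ^+ 2 * (D + 2)) / (D + 1) ^+ 2.
    by field; exact: lt0r_neq0.
  rewrite mulNr oppr_ge0 leNgt divr_gt0 ?exprn_gt0// mulr_gt0//; last by rewrite ltr_wpDl.
  by rewrite exprn_even_gt0.
apply/rowP => j; rewrite [RHS]mxE -(q0 'e_j) /qf trmx_delta -colE.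
by rewrite [RHS]mxE.
Qed.

End Components.

Theorem proposition4p18 (R : realType) (n : nat) (n_ge2 : (2 <= n)%N)
    (psi phi : 'rV[R]_n -> R)
    (psi_Mink : Minkowski_norm psi)
    (phi_hom : pos_homogeneous phi)
    (sum_weak : weak_Minkowski_norm (fun y => psi y + phi y))
    (hAB :
      (forall y, psi y <= phi y /\ (phi y = psi y -> y = 0)) \/
      (forall y, [/\ - psi y <= phi y, phi y <= psi y,
                     - psi y = phi y -> y = 0 & phi y = psi y -> y = 0]))
    (Phip Phim F : 'rV[R]_n -> 'rV[R]_n -> R)
    (hPhip : forall x y : 'rV[R]_n, Omega phi psi x ->
      unique (fun s : R => s = phi (y + s *: x) + psi (y + s *: x)) (Phip x y))
    (hPhim : forall x y : 'rV[R]_n, Omega phi psi x ->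
      unique (fun s : R => s = phi (y + s *: x) - psi (y + s *: x)) (Phim x y))
    (hF : forall x y : 'rV[R]_n, Omega phi psi x ->
      F x y = 2^-1 * (Phip x y - Phim x y))
    (U : set 'rV[R]_n)
    (U_comp : exists2 x0, Minkowski_locus (Omega phi psi) F x0 &
      U = connected_component (Minkowski_locus (Omega phi psi) F) x0)
    (U_convex : convex_set (U : set (convex_lmodType 'rV[R]_n))) :
  (forall x, smooth_boundary_point U x -> Omega phi psi x ->
     forall y, ~ tangent_at U x y ->
       posdef (hessian (fun z => F x z ^+ 2) y))
  /\
  (forall x, smooth_boundary_point U x -> Omega phi psi x ->
     exists y : 'rV[R]_n,
       [/\ y != 0,
           tangent_at U x y,
           eigenvalue (hessian (fun z => F x z ^+ 2) y) 0
         & forall theta : 'rV[R]_n, theta != 0 ->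
             (theta <= eigenspace (hessian (fun z => F x z ^+ 2) y) 0)%MS ->
             [/\ ~ (exists c : R, theta = c *: y),
                 \sum_(i < n) partial i (F x) y * theta 0 i = 0,
                 \sum_(i < n) \sum_(j < n)
                    partial j (partial i (F x)) y * theta 0 i * theta 0 j = 0
               & ~ tangent_at U x x ->
                 \forall t \near (0 : R)^',
                   0 < \sum_(i < n) \sum_(j < n)
                         partial j (partial i (F x)) (y + t *: x)
                           * theta 0 i * theta 0 j]]).
Proof.
have W_open := open_locus psi phi Phip Phim F psi_Mink phi_hom sum_weak hPhip hPhim hF.
have [x0 Ox0 UE] := U_comp.
set O := Minkowski_locus _ _ in W_open Ox0 UE.
have cU := convex_in_of_set U U_convex.
have oU : open U by rewrite UE; exact: open_component.
have U0 : U !=set0 by exists x0; rewrite UE; exact: connected_component_refl.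
have UO u : U u -> O u by rewrite UE => /connected_component_sub.
have Fsm := F_smooth psi phi Phip Phim F psi_Mink phi_hom sum_weak hPhip hPhim hF.
have Fhom := F_hom psi phi Phip Phim F psi_Mink phi_hom sum_weak hPhip hPhim hF.
have Fpos := F_pos psi phi Phip Phim F psi_Mink phi_hom sum_weak hPhip hPhim hF.
have tangent0 x : smooth_boundary_point U x -> tangent_at U x 0.
  move=> [_ [H HT]]; exists H => //; have [a [_ -> _]] := HT.1.
  by rewrite /= linear0.
have partA x : smooth_boundary_point U x -> Omega phi psi x ->
     forall y, ~ tangent_at U x y -> posdef (hessian (fun z => F x z ^+ 2) y).
  move=> sx Wx y ny.
  have y0 : y != 0 by apply/eqP => y0; apply: ny; rewrite y0; exact: tangent0.
  have [t /UO[Wt Mt]] := nontangent_hits U x y cU oU U0 sx ny.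
  apply/(posdef_sqr (F x) (Fsm x Wx) (Fhom x Wx) (fun y => Fpos x y Wx) y y0) => v vy.
  have pos := (Minkowski_posdef _ (Fsm _ Wt) (Fhom _ Wt) (fun y => Fpos _ y Wt)).1 Mt y v y0 vy.
  have E := F_line psi phi Phip Phim F psi_Mink phi_hom sum_weak hPhip hPhim hF x y t v v Wx Wt y0.
  exact: (eq_ind _ (fun r => 0 < r) pos _ E).
split; first exact: partA.
move=> x sx Wx.
have nOx : ~ O x.
  move=> Ox; have [[clx nint] _] := sx; apply: nint.
  have Ux : U x by rewrite UE; apply: closure_component => //; rewrite -UE.
  exact: near_open.
have [y [v [y0 v0 ypos]]] : exists y v, [/\ y != 0, v != 0 & ~ 0 < sqr_form F x y v].
  apply: contrapT => N; apply: nOx; split; first exact: Wx.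
  apply/(locus_posdef psi phi Phip Phim F psi_Mink phi_hom sum_weak hPhip hPhim hF x Wx) => y v y0 v0.
  by apply: contrapT => yv; apply: N; exists y, v.
have ytan : tangent_at U x y.
  apply: contrapT => /(partA x sx Wx y)[_ pd].
  by apply: ypos; exact: pd.
pose S := hessian (fun z => F x z ^+ 2) y.
have ST : S^T = S := hess_sqr_sym (F x) (Fsm x Wx) y y0.
have SE u w : qf S u w =
    2 * (dotp (grad (F x) y) u * dotp (grad (F x) y) w + F x y * qf (hessian (F x) y) u w).
  exact: (hess_sqr (F x) (Fsm x Wx) y u w y0).
have psd w : 0 <= qf S w w.
  rewrite leNgt; apply/negP => lt0.
  have cS := cvg_sqr_form psi phi Phip Phim F psi_Mink phi_hom sum_weak hPhip hPhim hF x y w Wx y0.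
  have cx : (fun x' : 'rV[R]_n => ((y, w), x')) @ x --> ((y, w), x).
    exact: (@cvg_pair _ _ _ (nbhs x) (nbhs (y, w)) (nbhs x) _ _ _ (fun=> (y, w)) id
      (cvg_cst _) cvg_id).
  have nx : nbhs x [set x' | sqr_form F x' y w < 0].
    exact: (cx _ (cvgr_lt _ cS _ lt0)).
  have w0 : w != 0.
    by apply: contraTneq lt0 => ->; rewrite /qf !mul0mx mxE ltxx.
  have [[clx _] _] := sx.
  have [u [/UO[Wu [_ pu]] /=]] := clx _ nx.
  by apply/negP; rewrite -leNgt; apply: ltW; exact: (pu y y0).2.
have vS : v *m S = 0.
  apply: (psd_kernel S v ST psd); apply/eqP; rewrite eq_le (psd v) andbT leNgt.
  by apply/negP; exact: ypos.
exists y; split; [exact: y0|exact: ytan| |].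
  by apply/eigenvalueP; exists v; [rewrite scale0r; exact: vS|exact: v0].
move=> theta th0 /eigenspaceP; rewrite scale0r -/S => thS.
have qth w : qf S theta w = 0 by rewrite /qf thS mul0mx mxE.
have Fy := Fpos x y Wx y0.
have py : dotp (grad (F x) y) y = F x y := grad_euler (F x) (Fsm x Wx) (Fhom x Wx) y y0.
have Ky := hess_euler (F x) (Fsm x Wx) (Fhom x Wx) y y0.
(* Evaluate the form at [(theta, y)]: [Hess F] annihilates [y] and [dF(y) = F(x, y) > 0], so only
   [dF(theta)] can vanish. *)
have pth : dotp (grad (F x) y) theta = 0.
  have qKy : qf (hessian (F x) y) theta y = 0 by rewrite /qf -mulmxA Ky mulmx0 mxE.
  have := etrans (esym (SE theta y)) (qth y); rewrite py qKy.
  rewrite mulr0 addr0 => /eqP; rewrite mulf_eq0 pnatr_eq0/= mulf_eq0 (gt_eqF Fy) orbF.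
  by move/eqP.
have qthth : qf (hessian (F x) y) theta theta = 0.
  have := etrans (esym (SE theta theta)) (qth theta); rewrite pth mulr0 add0r => /eqP.
  by rewrite mulf_eq0 pnatr_eq0/= mulf_eq0 (gt_eqF Fy)/= => /eqP.
have qsum (z w : 'rV[R]_n) : \sum_(i < n) \sum_(j < n) partial j (partial i (F x)) z * w 0 i * w 0 j =
    qf (hessian (F x) z) w w.
  rewrite qfE; apply: eq_bigr => i _; apply: eq_bigr => j _.
  exact: (congr1 (fun a : R => a * w 0 i * w 0 j) (esym (hessE (F x) z i j))).
have thy : ~ exists c : R, theta = c *: y.
  move=> [c cE]; have := pth; rewrite cE linearZ/= py => /eqP.
  rewrite mulf_eq0 (gt_eqF Fy) orbF => /eqP c0.
  by move: th0; rewrite cE c0 scale0r eqxx.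
split; [exact: thy| | |].
- apply: etrans pth; rewrite /dotp; apply: eq_bigr => i _.
  exact: (congr1 (fun a : R => a * theta 0 i) (esym (mxE _ _ _ _))).
- exact: etrans (qsum y theta) qthth.
move=> nx; have [H HT Hy] := ytan.
have [a [a0 HE _]] := HT.1.
have ay : dotp a y = 0 by move: Hy; rewrite HE.
have ax : dotp a x != 0.
  by apply/eqP => ax; apply: nx; exists H; [exact: HT|rewrite HE].
have ayt t : dotp a (y + t *: x) = t * dotp a x.
  have -> : dotp a (y + t *: x) = dotp a y + dotp a (t *: x) by rewrite linearD.
  by rewrite ay add0r linearZ.
have ntan (t : R) : t != 0 -> ~ tangent_at U x (y + t *: x).
  move=> t0 [H' HT'].
  have -> : H' = H by apply: HT.2; exact: HT'.1.
  by rewrite HE /= ayt => /eqP; rewrite mulf_eq0 (negPf t0) (negPf ax).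
(* Part (a) is used at the same point [x] in the direction [y + t *: x]; it gives positivity only
   transversally to that direction, so [theta] must not be parallel to it. *)
have good (t : R) : t != 0 -> ~ (exists c : R, theta = c *: (y + t *: x)) ->
    0 < qf (hessian (F x) (y + t *: x)) theta theta.
  move=> t0 nt; have nt' := ntan t t0.
  have yt0 : y + t *: x != 0 by apply/eqP => E; apply: nt'; rewrite E; exact: tangent0.
  exact: ((posdef_sqr (F x) (Fsm x Wx) (Fhom x Wx) (fun y => Fpos x y Wx) _ yt0).1
    (partA x sx Wx _ nt') theta nt).
(* At most one [t] makes [theta] parallel to [y + t *: x]: applying [a] gives [c1 * t1 = c * t], and
   cancelling the [x] terms then gives [c1 = c]. *)
have bad (t1 t : R) : t1 != 0 -> t != 0 ->
    (exists c : R, theta = c *: (y + t1 *: x)) -> (exists c : R, theta = c *: (y + t *: x)) -> t = t1.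
  move=> t10 t0 [c1 E1] [c E].
  have e : c1 * t1 = c * t.
    apply: (mulIf ax); rewrite -!mulrA -!ayt.
    have h k w : k * dotp a w = dotp a (k *: w) by rewrite linearZ.
    by rewrite !h -E1 -E.
  have c0 : c != 0 by apply: contra th0 => /eqP c0; rewrite E c0 scale0r.
  have cc : c1 = c.
    have : c1 *: y = c *: y.
      have := E1; rewrite E !scalerDr !scalerA e => /addIr.
      by move=> ->.
    move=> /eqP; rewrite -subr_eq0 -scalerBl scaler_eq0 (negPf y0) orbF subr_eq0.
    by move/eqP.
  by apply: (mulfI c0); rewrite -e cc.
have near_good : \forall t \near (0 : R)^', t != 0 /\ ~ (exists c : R, theta = c *: (y + t *: x)).
  (* The exceptional parameter [t1], if there is one, is nonzero, so [|t| < |t1|] avoids it. *)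
  have [[t1 [t10 bt1]]|N] := pselect (exists t1 : R, t1 != 0 /\ exists c : R, theta = c *: (y + t1 *: x)).
    near=> t.
    have t0 : t != 0 by near: t; exact: nbhs_dnbhs_neq.
    have tt1 : `|t| < `|t1| by near: t; apply: (@dnbhs0_lt _ R); rewrite normr_gt0.
    split; first exact: t0.
    by move=> bt; move: tt1; rewrite (bad t1 t t10 t0 bt1 bt) ltxx.
  near=> t.
  have t0 : t != 0 by near: t; exact: nbhs_dnbhs_neq.
  split; first exact: t0.
  by move=> bt; apply: N; exists t; exact: (conj t0 bt).
apply: filterS near_good => t [t0 nt]; rewrite qsum; exact: good.
Unshelve. all: by end_near. Qed.
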